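(* Let $Z$ be a discrete Gibbs measure random variable on $\{0,1,\dots,N\}$ with parameters $w,U,\beta$ satisfying $e^{U(m+1)-U(m)}=a+bm$, and let $\bar g_0$ be the solution to the Stein equation for $Z$ (with bounded right-hand test function $f$), satisfying $$\|\Delta\bar g_0\|\le\bar w_1\|f\|\min(1,\bar\gamma^{-1}),$$ where $\bar w_1,\bar\gamma>0$. Define $$\bar w_2=(2+qp)a(p)\left\{(n-k)\big(|1-wb|a(p)\delta+|wb|\big)+|1-wb|a(p)\big(\delta^*c_{n,k}^{(1)}+c_{n,k}^{(2)}\big)\right\}.$$ Assume that $n\ge5k$, $\bar w_1\bar w_2<\bar\gamma$, ${\mathbb E}\big(S_{k_1,k_2}^n\big)={\mathbb E}\big(M_{k_1,k_2}^n\big)$ and ${\mathbb E}(Z)={\mathbb E}\big(S_{k_1,k_2}^n\big)$, and put $\tau=\mathrm{Var}\big(M_{k_1,k_2}^n\big)-\mathrm{Var}\big(S_{k_1,k_2}^n\big)$. Then $$d_{TV}\left(Z,M_{k_1,k_2}^n\right)\le\frac{\bar\gamma}{2(\bar\gamma-\bar w_1\bar w_2)}\left(\bar w_1\bar\varepsilon^*\min(1,\bar\gamma^{-1})+2{\mathbb P}(S_{k_1,k_2}^n>N)+2{\mathbb P}(M_{k_1,k_2}^n>N)\right)+d_{TV}(Z,S_{k_1,k_2}^n),$$ where $$\begin{aligned}\bar\varepsilon^*=2\Bigg\{&|1-wb|\Bigg[\sum_{i=1}^{n-k}\sum_{|j-i|\le k+1}\Bigg(\Big(\sum_{u=i-2k-2}^{j-1}+\sum_{u=i+k+2}^{i+2k+2}\Big)\big[{\mathbb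 E}({\mathbb I}_i){\mathbb E}({\mathbb I}_j{\mathbb I}_u)+{\mathbb E}({\mathbb I}_i{\mathbb I}_j{\mathbb I}_u)\big]\\&\qquad+\big[{\mathbb E}({\mathbb I}_i){\mathbb E}({\mathbb I}_j)+{\mathbb E}({\mathbb I}_i{\mathbb I}_j)\big]\sum_{|u-i|\le2k+2}{\mathbb E}({\mathbb I}_u)\Bigg)+\frac{|\tau|}{2}+(2+qp)h_1(n,k,p)a(p)^3\Bigg]\\&+|wb|\Bigg[\sum_{i=1}^{n-k}\Bigg(\sum_{|j-i|\le k+1}{\mathbb E}({\mathbb I}_i{\mathbb I}_j)+{\mathbb E}({\mathbb I}_i)\sum_{|j-i|\le k+1}{\mathbb E}({\mathbb I}_j)\Bigg)+(2+qp)h_2(n,k,p)a(p)^2\Bigg]\Bigg\},\end{aligned}$$ and where the last term $d_{TV}(Z,S_{k_1,k_2}^n)$ is given by the bound $$d_{TV}(Z,S_{k_1,k_2}^n)\le\|\Delta g\|\left\{2(2+qp)a(p)^2\big(|1-wb|h_1(n,k,p)a(p)+|wb|h_2(n,k,p)\big)+|\varphi(1-wb)|\right\},\qquad\varphi=\mathrm{Var}(Z)-\mathrm{Var}\big(S_{k_1,k_2}^n\big),$$ with $\|\Delta g\|$ the supremum of $\|\Delta g_f\|$ over Stein solutions $g_f$ for $Z$ with test functions $f=\mathbf 1(A)$, $A\subseteq{\mathbb Z}$.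
   Context: Runs. Fix integers $k_1,k_2\ge1$ and put $k=k_1+k_2$. Let $\eta_1,\dots,\eta_n$ be independent Bernoulli trials with ${\mathbb P}(\eta_i=1)=p_i=1-q_i=1-{\mathbb P}(\eta_i=0)$, and set $\eta_0=1$. For $1\le l\le n-k$ let $${\mathbb I}_l=\eta_{l-1}\Big[\prod_{i=1}^{k_1}(1-\eta_{l+i-1})\prod_{j=1}^{k_2}\eta_{l+k_1+j-1}\Big](1-\eta_{l+k}),\qquad M_{k_1,k_2}^n=\sum_{l=1}^{n-k}{\mathbb I}_l ,$$ and ${\mathbb I}_l:=0$ for $l\notin\{1,\dots,n-k\}$. All ${\mathbb I}$'s in the claim refer to these (non-identical) trials. $S_{k_1,k_2}^n$ denotes the random variable defined in the same way from independent identically distributed trials with success probability $p\in(0,1)$, $q=1-p$. Write $a(p)=q^{k_1}p^{k_2}$ (not to be confused with the constant $a$ below). Discrete Gibbs measure. $Z$ has PMF ${\mathbb P}(Z=m)=\frac1\beta\frac{e^{U(m)}w^m}{m!}$ for $m\in\mathcal S=\{0,1,\dots,N\}$ ($N$ may be $\infty$), where $w>0$, $U:\mathcal S\to{\mathbb R}$ and $\beta=\sum_{m\in\mathcal S}e^{U(m)}w^m/m!$. It is assumed that $e^{U(m+1)-U(m)}=a+bm$ for constants $a,b\in{\mathbb R}$. For such $Z$ the paper uses (from $G'(t)=\frac{wa}{1-wbt}G(t)$, $G$ the probability generating function of $Z$) ${\mathbb E}(Z)=\frac{wa}{1-wb}$ and $\mathrm{Var}(Z)=\frac{wa}{(1-wb)^2}$.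 Stein equation and distance. The Stein operator of $Z$ is ${\cal A}_Zg(m)=w\,e^{U(m+1)-U(m)}g(m+1)-m\,g(m)=w(a+bm)g(m+1)-mg(m)$, $m\in\mathcal S$, acting on bounded functions $g$ on ${\mathbb Z}$ with $g(0)=0$ and $g(x)=0$ for $x\notin\mathcal S$. For bounded $f:{\mathbb Z}\to{\mathbb R}$, the solution $g=g_f$ of the Stein equation satisfies ${\cal A}_Zg(m)=f(m)-{\mathbb E}f(Z)$. $\|f\|$ is the supremum norm, $\Delta g(j)=g(j+1)-g(j)$, $\|\Delta g\|=\sup_{j\in{\mathbb Z}_+}|\Delta g(j)|$, where ${\mathbb Z}_+=\{0,1,2,\dots\}$. $d_{TV}(X,Y)=\sup_{A\subseteq{\mathbb Z}}|{\mathbb P}(X\in A)-{\mathbb P}(Y\in A)|$. Constants. $\delta^*=1+q+qp$, $\delta=2+\delta^*(k+2)$, $\delta_1=\delta^*\big(5k+6+\frac{3k^2+11k+10}{2}\delta^*\big)$, $\delta_2=\delta^*\big(3+\frac{4k+7}{2}\delta^*\big)$, $c_{n,k}^{(1)}=(n-2k-2)(k+1)+\frac{(k+1)^{n-k+1}}{(k+2)^{n-k-1}}$, $c_{n,k}^{(2)}=n-3k+k\big(\frac{k+1}{k+2}\big)^{n-2k}$, $c_{n,k}^{(3)}=n-5k+k(nk+6k+4-k^2)\frac{(k+1)^{n-3k-1}}{(k+2)^{n-3k+1}}$, $c_{n,k}^{(4)}=n(3k+1)-(11k^2+9k+2)+(2nk+k^2+7k+2)\big(\frac{k+1}{k+2}\big)^{n-2k}$,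 $c_{n,k}^{(5)}=n(2k+3)-6k^2-16k-10+(2n+2k+5)\frac{(k+1)^{n-k}}{(k+2)^{n-k-1}}$, $$h_1(n,k,p)=(n-k)(4+\delta_1)+\delta_2c_{n,k}^{(1)}+\delta c_{n,k}^{(2)}+c_{n,k}^{(3)}+\delta^*c_{n,k}^{(4)}+\frac{{\delta^*}^2}{2}c_{n,k}^{(5)},$$ $$h_2(n,k,p)=(n-k)\delta+\delta^*c_{n,k}^{(1)}+c_{n,k}^{(2)}.$$ *)

(* Defs.v *)
From HB Require Import structures.
From mathcomp Require Import all_boot all_order all_algebra.
From mathcomp Require Import all_classical all_reals all_analysis.

Set Implicit Arguments.
Unset Strict Implicit.
Unset Printing Implicit Defensive.

Import Order.TTheory GRing.Theory Num.Theory.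
Import numFieldNormedType.Exports.

Local Open Scope classical_set_scope.
Local Open Scope ring_scope.

(** * Probability *)

(* X 1, ..., X n are mutually independent: the product rule holds for every
   subfamily J.  The values X i for i = 0 or i > n play no role. *)
Definition mutually_independent d d' (T : measurableType d)
    (T' : measurableType d') (R : realType) (P : probability T R)
    (X : nat -> T -> T') (n : nat) : Prop :=
  forall (J : {set 'I_n}) (B : 'I_n -> set T'),
    (forall i, measurable (B i)) ->
    P (\bigcap_(i in [set i | i \in J]) (X i.+1 @^-1` B i)) =
    (\prod_(i in J) P (X i.+1 @^-1` B i))%E.

Definition bernoulli_trials d (T : measurableType d) (R : realType)
    (P : probability T R) (eta : nat -> T -> bool) (n : nat) (ps : nat -> R)
    : Prop :=
  (forall i, (1 <= i <= n)%N -> P [set t | eta i t = true] = (ps i)%:E) /\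
  mutually_independent P eta n.

(* For integer-valued X and Y, possibly on different probability spaces. *)
Definition dTV d1 d2 (T1 : measurableType d1) (T2 : measurableType d2)
    (R : realType) (P : probability T1 R) (X : T1 -> int)
    (Q : probability T2 R) (Y : T2 -> int) : R :=
  sup [set `| fine (P (X @^-1` A)) - fine (Q (Y @^-1` A)) | | A in [set: set int]].

(** * Runs *)

Section runs.
Variables (T : Type) (k1 k2 n : nat) (eta : nat -> T -> bool).

(* The trials with the convention eta_0 = 1. *)
Definition trial (i : nat) (t : T) : nat :=
  if i is 0 then 1%N else eta i t : nat.

(* Integer index, since the sums of the theorem range outside 1, ..., n - k;
   for 1 <= m the natural subtractions are exact. *)
Definition runI (l : int) (t : T) : nat :=
  match l with
  | Posz m =>
    if (1 <= m <= n - (k1 + k2))%N then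
      (trial (m - 1) t *
       ((\prod_(1 <= i < k1.+1) (1 - trial (m + i - 1) t)) *
        \prod_(1 <= j < k2.+1) trial (m + k1 + j - 1) t) *
       (1 - trial (m + (k1 + k2)) t))%N
    else 0%N
  | Negz _ => 0%N
  end.

Definition runM (t : T) : nat :=
  (\sum_(1 <= l < (n - (k1 + k2)).+1) runI l%:Z t)%N.

End runs.

(* The integers lo, lo + 1, ..., hi (none if hi < lo). *)
Definition zseq (lo hi : int) : seq int :=
  if lo <= hi then [seq lo + m%:Z | m <- iota 0 (absz (hi - lo)).+1] else [::].

(** * Discrete Gibbs measures and their Stein equation *)

(* The upper end point N of the support is [None] for infinity. *)
Definition gibbs_supp (N : option nat) (m : nat) : bool :=
  if N is Some N0 then (m <= N0)%N else true.

(* e^{U(m)}, read as 0 outside the support. *)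
Definition gibbs_exp (R : realType) (N : option nat) (U : nat -> R) (m : nat)
    : R :=
  if gibbs_supp N m then expR (U m) else 0.

Definition is_gibbs d (T : measurableType d) (R : realType)
    (P : probability T R) (Z : T -> nat) (N : option nat) (w : R)
    (U : nat -> R) (beta : R) : Prop :=
  [/\ 0 < w,
      (\sum_(0 <= m <oo) (gibbs_exp N U m * w ^+ m / m`!%:R)%:E = beta%:E)%E &
      forall m, P [set t | Z t = m] =
                (beta^-1 * (gibbs_exp N U m * w ^+ m / m`!%:R))%:E].

(* e^{U(m+1) - U(m)} = a + b m for every m in the support.  For finite N and
   m = N the left-hand side is 0, i.e. U(N+1) = -oo: this is what makes
   G'(t) = w a / (1 - w b t) G(t) hold for the generating function G. *)
Definition gibbs_ratio (R : realType) (N : option nat) (U : nat -> R)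
    (a b : R) : Prop :=
  forall m, gibbs_supp N m ->
    gibbs_exp N U m.+1 / gibbs_exp N U m = a + b * m%:R.

Definition supnorm (R : realType) (f : int -> R) : R :=
  sup [set `|f x| | x in [set: int]].

Definition Dnorm (R : realType) (g : int -> R) : R :=
  sup [set `|g (j%:Z + 1) - g j%:Z| | j in [set: nat]].

Definition stein_op (R : realType) (w a b : R) (g : int -> R) (m : nat) : R :=
  w * (a + b * m%:R) * g (m%:Z + 1) - m%:R * g m%:Z.

Definition stein_solution d (T : measurableType d) (R : realType)
    (P : probability T R) (Z : T -> nat) (N : option nat) (w a b : R)
    (f g : int -> R) : Prop :=
  [/\ bounded_fun g,
      g 0 = 0,
      (forall x : int, ~ (exists2 m, gibbs_supp N m & x = m%:Z) -> g x = 0) &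
      forall m, gibbs_supp N m ->
        stein_op w a b g m = f m%:Z - fine 'E_P[fun t => f (Z t)%:Z]].

(* Supremum of the norms of the differences of the Stein solutions for the
   indicators of subsets of the integers. *)
Definition stein_Dnorm d (T : measurableType d) (R : realType)
    (P : probability T R) (Z : T -> nat) (N : option nat) (w a b : R) : R :=
  sup [set r | exists (A : set int) (g : int -> R),
         stein_solution P Z N w a b \1_A g /\ r = Dnorm g].

(** * Constants *)

Section constants.
Variable R : realType.
Implicit Types (n k : nat) (p : R).

Definition dstar p : R := 1 + (1 - p) + (1 - p) * p.

Definition delta k p : R := 2 + dstar p * (k%:R + 2).

Definition delta1 k p : R :=
  dstar p * (5 * k%:R + 6 + (3 * k%:R ^+ 2 + 11 * k%:R + 10) / 2 * dstar p).

Definition delta2 k p : R :=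
  dstar p * (3 + (4 * k%:R + 7) / 2 * dstar p).

(* The exponents are natural subtractions, exact when n >= 5k and k >= 2. *)
Definition c1 n k : R :=
  (n%:R - 2 * k%:R - 2) * (k%:R + 1) +
  (k%:R + 1) ^+ (n - k + 1) / (k%:R + 2) ^+ (n - k - 1).

Definition c2 n k : R :=
  n%:R - 3 * k%:R + k%:R * ((k%:R + 1) / (k%:R + 2)) ^+ (n - 2 * k).

Definition c3 n k : R :=
  n%:R - 5 * k%:R +
  k%:R * (n%:R * k%:R + 6 * k%:R + 4 - k%:R ^+ 2) *
  ((k%:R + 1) ^+ (n - 3 * k - 1) / (k%:R + 2) ^+ (n - 3 * k + 1)).

Definition c4 n k : R :=
  n%:R * (3 * k%:R + 1) - (11 * k%:R ^+ 2 + 9 * k%:R + 2) +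
  (2 * n%:R * k%:R + k%:R ^+ 2 + 7 * k%:R + 2) *
  ((k%:R + 1) / (k%:R + 2)) ^+ (n - 2 * k).

Definition c5 n k : R :=
  n%:R * (2 * k%:R + 3) - 6 * k%:R ^+ 2 - 16 * k%:R - 10 +
  (2 * n%:R + 2 * k%:R + 5) *
  ((k%:R + 1) ^+ (n - k) / (k%:R + 2) ^+ (n - k - 1)).

Definition h1 n k p : R :=
  (n%:R - k%:R) * (4 + delta1 k p) + delta2 k p * c1 n k + delta k p * c2 n k
  + c3 n k + dstar p * c4 n k + dstar p ^+ 2 / 2 * c5 n k.

Definition h2 n k p : R :=
  (n%:R - k%:R) * delta k p + dstar p * c1 n k + c2 n k.

Definition arun (k1 k2 : nat) p : R := (1 - p) ^+ k1 * p ^+ k2.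

Definition w2bar (k1 k2 n : nat) (w b p : R) : R :=
  let k := (k1 + k2)%N in let ap := arun k1 k2 p in
  (2 + (1 - p) * p) * ap *
  ((n%:R - k%:R) * (`|1 - w * b| * ap * delta k p + `|w * b|)
   + `|1 - w * b| * ap * (dstar p * c1 n k + c2 n k)).

End constants.

Section epsilon.
Context d (T : measurableType d) (R : realType) (P : probability T R).
Variables (k1 k2 n : nat) (eta : nat -> T -> bool).

Let k := (k1 + k2)%N.
Let I (l : int) (t : T) : R := (runI k1 k2 n eta l t)%:R.

Definition EI1 (i : int) : R := fine 'E_P[I i].
Definition EI2 (i j : int) : R := fine 'E_P[fun t => I i t * I j t].
Definition EI3 (i j u : int) : R := fine 'E_P[fun t => I i t * I j t * I u t].

Definition epsbar (w b p tau : R) : R :=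
  2 * (`|1 - w * b| *
         (\sum_(1 <= i0 < (n - k).+1)
            (let i := i0%:Z in
             \sum_(j <- zseq (i - k%:Z - 1) (i + k%:Z + 1))
               (\sum_(u <- zseq (i - 2 * k%:Z - 2) (j - 1) ++
                           zseq (i + k%:Z + 2) (i + 2 * k%:Z + 2))
                  (EI1 i * EI2 j u + EI3 i j u)
                + (EI1 i * EI1 j + EI2 i j) *
                  \sum_(u <- zseq (i - 2 * k%:Z - 2) (i + 2 * k%:Z + 2)) EI1 u))
          + `|tau| / 2
          + (2 + (1 - p) * p) * h1 n k p * arun k1 k2 p ^+ 3)
       + `|w * b| *
         (\sum_(1 <= i0 < (n - k).+1)
            (let i := i0%:Z in
             \sum_(j <- zseq (i - k%:Z - 1) (i + k%:Z + 1)) EI2 i j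
             + EI1 i * \sum_(j <- zseq (i - k%:Z - 1) (i + k%:Z + 1)) EI1 j)
          + (2 + (1 - p) * p) * h2 n k p * arun k1 k2 p ^+ 2)).

End epsilon.

(* Main.v *)
Require Import Defs.
From mathcomp Require Import all_boot all_order all_algebra.
From mathcomp Require Import all_classical all_reals all_analysis.
From mathcomp Require Import zify ring lra.

Set Implicit Arguments.
Unset Strict Implicit.
Unset Printing Implicit Defensive.

Import Order.TTheory GRing.Theory Num.Theory.
Import numFieldNormedType.Exports.

Local Open Scope classical_set_scope.
Local Open Scope ring_scope.

(** Both [M] and [S] are sums of indicators [I_l] that are locally dependent:
  the families of indicators on two sets of indices more than [k + 1] apart
  are independent.  Writing [A_Z] for the Stein operator of [Z] and using
  [E Z = w a / (1 - w b)], one has, for a sum [W] with the mean of [Z],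
  [[
    E (A_Z g) (W) = (1 - w b) (E W E g (W + 1) - E (W g (W)))
                    + w b E (W (g (W + 1) - g (W))).
  ]]
  Removing from [W] the neighbourhood of one index and expanding [g] twice
  turns the right-hand side into [c_W E (g (W + 2) - g (W + 1))] plus an error
  that is at most [sup |g (j + 1) - g (j)|] times twice a sum of products of at
  most three indicators ([ld_stein]).  Here
  [c_W = E W - (1 - w b) Var W = (1 - w b) (Var Z - Var W)], because
  [(1 - w b) Var Z = E Z] ([gibbs_variance]).

  Centring at [W + 1] rather than at [W] removes the diagonal terms [j = i],
  so that for i.i.d. trials the triple sum is of order [a(p)^3] and the double
  sum of order [a(p)^2].  Two distinct runs start at least [k] apart, a run
  has mean at most [a(p) / 4] unless it is the first one, and counting indices
  gives polynomials in [n] and [k] that lie below [(2 + q p) h_1] and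
  [(2 + q p) h_2] ([iid_ld3], [iid_ld2]).  For [M] the same sums are bounded by
  those in the error term of the theorem ([ld3_runs_le], [ld2_runs_le]).

  The bound on the distance from [Z] to [S] applies this to the Stein solutions
  of indicators.  They are explicit ([stein_sol_solution]).  If the support is
  [{0, ..., N}], they vanish beyond [N] and do not see the event [S > N]; the
  solution is therefore continued linearly beyond [N], which keeps its
  increments bounded by the same constant and makes the Stein operator dominate
  the indicator on all integers ([stein_extension]).

  For [M], take the difference of the two expansions for the same solution
  [g]: the coefficients differ by [(1 - w b)] times [tau], and what remains is
  [c_S] times the difference of the expectations of the bounded function
  [g (. + 2) - g (. + 1)] at [S] and at [M].  The latter is at most
  [2 sup |g (j + 1) - g (j)|] times the distance from [S] to [M]
  ([pexp_dist]), and [|c_S| <= w2] ([w2bar_ge]); the condition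
  [w1 * w2 < gamma] lets this distance be absorbed into the left-hand side.
  The test functions are [1_A - 1/2], whose supremum norm is 1/2.

  All expectations of functions of the trials are computed on the finite
  product space [{ffun 'I_n -> bool}]. *)

(** * Expectation of independent Bernoulli trials *)

Section product_expectation.
Variables (R : realType) (I : finType) (ps : I -> R).

Definition pweight (x : {ffun I -> bool}) : R :=
  \prod_i (if x i then ps i else 1 - ps i).

Definition pexp (F : {ffun I -> bool} -> R) : R := \sum_x pweight x * F x.

Definition depends_on V (F : {ffun I -> bool} -> V) (A : {set I}) :=
  forall x y : {ffun I -> bool}, {in A, x =1 y} -> F x = F y.

Lemma eq_pexp F G : F =1 G -> pexp F = pexp G.
Proof. by move=> FG; apply: eq_bigr => x _; rewrite FG. Qed.

Lemma pexpD F G : pexp (fun x => F x + G x) = pexp F + pexp G.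
Proof.
by rewrite /pexp -big_split; apply: eq_bigr => x _; rewrite mulrDr.
Qed.

Lemma pexpZ c F : pexp (fun x => c * F x) = c * pexp F.
Proof. by rewrite /pexp mulr_sumr; apply: eq_bigr => x _; rewrite mulrCA. Qed.

Lemma pexpB F G : pexp (fun x => F x - G x) = pexp F - pexp G.
Proof.
by rewrite /pexp -sumrB; apply: eq_bigr => x _; rewrite mulrBr.
Qed.

Lemma pexp_sum J (r : seq J) (P : pred J) (F : J -> {ffun I -> bool} -> R) :
  pexp (fun x => \sum_(j <- r | P j) F j x) = \sum_(j <- r | P j) pexp (F j).
Proof.
rewrite /pexp exchange_big; apply: eq_bigr => x _.
by rewrite mulr_sumr.
Qed.

Lemma pexp_prod_coord (f : I -> bool -> R) :
  pexp (fun x => \prod_i f i (x i)) =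
  \prod_i (ps i * f i true + (1 - ps i) * f i false).
Proof.
rewrite /pexp.
transitivity (\sum_(x : {ffun I -> bool})
    \prod_i ((if x i then ps i else 1 - ps i) * f i (x i))).
  by apply: eq_bigr => x _; rewrite big_split.
rewrite -(bigA_distr_bigA (fun i (b : bool) =>
    (if b then ps i else 1 - ps i) * f i b)).
by apply: eq_bigr => i _; rewrite big_bool.
Qed.

Lemma pexp_cst c : pexp (fun=> c) = c.
Proof.
rewrite -[RHS]mulr1 -[in LHS](mulr1 c) pexpZ; congr (_ * _).
have -> : pexp (fun=> 1) = pexp (fun x => \prod_i (fun=> fun=> 1) i (x i)).
  by apply: eq_pexp => x; rewrite big1.
by rewrite (pexp_prod_coord (fun=> fun=> 1)) big1// => i _; ring.
Qed.

(** Exchanging the coordinates outside [A] between two independent copies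
  [x], [y] of the trials preserves the product weight; [F x * G y] becomes
  [F x * G x], and the second copy integrates to one. *)
Lemma pexpM (F G : {ffun I -> bool} -> R) (A : {set I}) :
  depends_on F A -> depends_on G (~: A) ->
  pexp (fun x => F x * G x) = pexp F * pexp G.
Proof.
move=> FA GA.
pose mix (x y : {ffun I -> bool}) := [ffun i => if i \in A then x i else y i].
pose swap (u : {ffun I -> bool} * {ffun I -> bool}) := (mix u.1 u.2, mix u.2 u.1).
have swapK : involutive swap.
  move=> [x y]; rewrite /swap /=.
  by apply: (f_equal2 pair); apply/ffunP => i; rewrite !ffunE;
     case: (i \in A).
transitivity (\sum_(u : {ffun I -> bool} * {ffun I -> bool})
    pweight u.1 * pweight u.2 * (F u.1 * G u.1)).
  rewrite -(pair_bigA _ (fun x y => pweight x * pweight y * (F x * G x)))/=.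
  rewrite /pexp; apply: eq_bigr => x _.
  have := pexp_cst 1; rewrite /pexp => e.
  rewrite -[LHS]mulr1 -e mulr_sumr; apply: eq_bigr => y _; ring.
rewrite (reindex_inj (inv_inj swapK)) /=.
rewrite mulr_suml.
transitivity (\sum_x \sum_y pweight x * pweight y * (F x * G y)); last first.
  apply: eq_bigr => x _; rewrite mulr_sumr; apply: eq_bigr => y _; ring.
rewrite pair_bigA /=; apply: eq_bigr => -[x y] _ /=; congr (_ * (_ * _)).
- rewrite /pweight -!big_split /=; apply: eq_bigr => i _.
  by rewrite !ffunE; case: (i \in A) => //; rewrite mulrC.
- by apply: FA => i iA; rewrite ffunE iA.
- by apply: GA => i; rewrite inE ffunE => /negbTE ->.
Qed.

Hypothesis ps01 : forall i, 0 <= ps i <= 1.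

Lemma pweight_ge0 x : 0 <= pweight x.
Proof.
by apply: prodr_ge0 => i _; case: ifP => _; have /andP[? ?] := ps01 i; lra.
Qed.

Lemma le_pexp F G : (forall x, F x <= G x) -> pexp F <= pexp G.
Proof. by move=> FG; apply: ler_sum => x _; rewrite ler_wpM2l// pweight_ge0. Qed.

Lemma pexp_ge0 F : (forall x, 0 <= F x) -> 0 <= pexp F.
Proof. by move=> F0; rewrite -(pexp_cst 0) le_pexp. Qed.

Lemma ler_norm_pexp F : `|pexp F| <= pexp (fun x => `|F x|).
Proof.
apply: (le_trans (ler_norm_sum _ _ _)); apply: ler_sum => x _.
by rewrite normrM (ger0_norm (pweight_ge0 x)).
Qed.

Lemma depends_onS V (F : {ffun I -> bool} -> V) (A B : {set I}) :
  A \subset B -> depends_on F A -> depends_on F B.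
Proof. by move=> /fintype.subsetP AB FA x y xy; apply: FA => i /AB /xy. Qed.

End product_expectation.

(** * Local dependence *)

Section local_dependence.
Variables (R : realType) (I : finType) (ps : I -> R).
Hypothesis ps01 : forall i, 0 <= ps i <= 1.
Variables (m r : nat) (X : nat -> {ffun I -> bool} -> nat) (A : nat -> {set I}).

Definition close_to (s i j : nat) := (i <= j + s)%N && (j <= i + s)%N.

Hypothesis X1 : forall i x, (X i x <= 1)%N.
Hypothesis XA : forall i, depends_on (X i) (A i).
Hypothesis Afar : forall i j, ~~ close_to r i j -> A j \subset ~: A i.

Local Notation E := (pexp ps).
Local Notation W x := (\sum_(1 <= i < m.+1) X i x)%N.

Let e1 i : R := E (fun x => (X i x)%:R).
Let e2 i j : R := E (fun x => (X i x)%:R * (X j x)%:R).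
Let e3 i j u : R := E (fun x => (X i x)%:R * (X j x)%:R * (X u x)%:R).

(** [ld2] and [ld3] are the error sums of the expansions of first and second
  order around [W + 1].  The diagonal [j = i] is left out of the joint moments
  because [X i] has already been counted in the shift by one.  In [ld3] the
  neighbours [j] of [i] are put back in increasing order, so that the index [u]
  runs over what separates the sum present before [j] from the part of [W]
  independent of [(X i, X j)]. *)
Definition ld2 : R :=
  \sum_(1 <= i < m.+1)
    (\sum_(1 <= j < m.+1 | close_to r i j && (j != i)) e2 i j
     + e1 i * \sum_(1 <= j < m.+1 | close_to r i j) e1 j).

Definition ld3 : R :=
  \sum_(1 <= i < m.+1) \sum_(1 <= j < m.+1 | close_to r i j)
    (\sum_(1 <= u < m.+1 | close_to (r + r) i u && ((u < j)%N || ~~ close_to r i u))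
       (e1 i * e2 j u + (if (j != i) && (u != i) then e3 i j u else 0))
     + (e1 i * e1 j + (if j != i then e2 i j else 0))
       * \sum_(1 <= u < m.+1 | close_to (r + r) i u) e1 u).

Definition ldmean : R := E (fun x => (W x)%:R).
Definition ldvar : R := E (fun x => ((W x)%:R - ldmean) ^+ 2).

Let S (P : pred nat) x := (\sum_(1 <= u < m.+1 | P u) X u x)%N.

Let S_dep P : depends_on (S P) (\bigcup_(u < m.+1 | P u) A u).
Proof.
move=> x y xy; rewrite /S big_nat_cond [RHS]big_nat_cond.
apply: eq_bigr => u /andP[/andP[u1 um] Pu].
apply: XA => i iA; apply: xy; apply/bigcupP; exists (Ordinal um) => //.
Qed.

Let farM (B : {set I}) (F : {ffun I -> bool} -> R) (P : pred nat)
    (h : nat -> R) : depends_on F B ->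
  (forall u, P u -> A u \subset ~: B) ->
  E (fun x => F x * h (S P x)) = E F * E (fun x => h (S P x)).
Proof.
move=> FB BP; apply: (@pexpM _ _ _ _ _ B) => //.
apply: (@depends_onS _ _ _ (\bigcup_(u < m.+1 | P u) A u)).
  by apply/bigcupsP => u /BP.
by move=> x y xy; rewrite (S_dep xy).
Qed.

Let natXdep i : depends_on (fun x => (X i x)%:R : R) (A i).
Proof. by move=> x y /XA ->. Qed.

Let natXXdep i j :
  depends_on (fun x => (X i x)%:R * (X j x)%:R : R) (A i :|: A j).
Proof.
move=> x y xy; congr (_%:R * _%:R); apply: XA => c cA; apply: xy;
  by rewrite inE cA ?orbT.
Qed.

(** Since each [Y j] is 0 or 1, adding it moves the argument by one increment
  of [h] or not at all. *)
Lemma telescope_diff (h : nat -> R) (Y : nat -> nat) (s : nat) a0 :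
  (forall j, (Y j <= 1)%N) ->
  h (a0 + \sum_(1 <= j < s.+1) Y j)%N - h a0 =
  \sum_(1 <= j < s.+1)
    (Y j)%:R * (h (a0 + \sum_(1 <= u < j) Y u).+1
                - h (a0 + \sum_(1 <= u < j) Y u)%N).
Proof.
move=> Y1; elim: s => [|s IH]; first by rewrite !big_nil addn0 subrr.
rewrite !(@big_nat_recr _ _ _ s.+1 1)//= -IH.
set t := (\sum_(_ <= _ < _) _)%N.
case: (Y s.+1) (Y1 s.+1) => [|[]]//= _.
  by rewrite addn0 mul0r addr0.
by rewrite addn1 addnS mul1r; ring.
Qed.

Lemma bounded_var (h : nat -> R) D y s : (forall j, `|h j| <= D) ->
  `|h (y + s)%N - h y| <= 2 * D * s%:R.
Proof.
move=> hD; case: s => [|s]; first by rewrite addn0 subrr normr0 mulr0.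
apply: (le_trans (ler_normB _ _)).
have D0 : 0 <= D by apply: le_trans (hD 0%N).
have := hD y; have := hD (y + s.+1)%N.
have : 0 <= D * s%:R by rewrite mulr_ge0.
rewrite -natr1 => *; lra.
Qed.

(** [F] is independent of the far part [S (predC N)].  Passing from the
  argument in the first expectation to the far part costs [2 * D] for each
  indicator [X u] with [Q u], and passing from the far part to [W], once [F]
  has been factored out, [2 * D] for each one with [N u]. *)
Lemma pexp_approx (g : nat -> R) D (N Q : pred nat) F (B : {set I}) :
  (forall j, `|g j| <= D) -> (forall x, 0 <= F x) ->
  depends_on F B -> (forall u, ~~ N u -> A u \subset ~: B) ->
  `|E (fun x => F x * g (S (predC N) x + S Q x)%N)
    - E F * E (fun x => g (W x))|
  <= 2 * D * (\sum_(1 <= u < m.+1 | Q u) E (fun x => F x * (X u x)%:R)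
              + E F * \sum_(1 <= u < m.+1 | N u) e1 u).
Proof.
move=> gD F0 FB BN.
have D0 : 0 <= D by apply: le_trans (gD 0%N).
rewrite -(subrKA (E F * E (fun x => g (S (predC N) x)))).
apply: (le_trans (ler_normD _ _)); rewrite [leRHS]mulrDr; apply: lerD.
  rewrite -(farM _ FB) -?pexpB; last by move=> u; exact: BN.
  apply: (le_trans (ler_norm_pexp ps01 _)).
  rewrite -pexp_sum -pexpZ; apply: le_pexp => // x.
  rewrite -mulrBr normrM ger0_norm// -mulr_sumr mulrCA ler_wpM2l//.
  by rewrite -natr_sum; exact: bounded_var.
rewrite -mulrBr normrM ger0_norm ?pexp_ge0// mulrCA ler_wpM2l ?pexp_ge0//.
rewrite -pexpB; apply: (le_trans (ler_norm_pexp ps01 _)).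
rewrite -pexp_sum -pexpZ; apply: le_pexp => // x.
rewrite -natr_sum distrC.
have -> : W x = (S (predC N) x + S N x)%N.
  by rewrite (bigID N) addnC.
exact: bounded_var.
Qed.

Variables (g : nat -> R) (D : R).
Hypothesis gD : forall j, `|g j.+1 - g j| <= D.

Let dg j := g j.+1 - g j.

Let W_split (N : pred nat) x : W x = (S (predC N) x + S N x)%N.
Proof. by rewrite (bigID N) addnC. Qed.

(** Where [X i] does not vanish it equals one, and can be split off [W]. *)
Let X_absorb i x (N : pred nat) (h : nat -> R) : (1 <= i < m.+1)%N -> N i ->
  (X i x)%:R * h (W x) =
  (X i x)%:R * h (S (predC N) x + S (fun u => N u && (u != i)) x).+1.
Proof.
move=> im Ni; rewrite (W_split N).
have -> : S N x = (X i x + S (fun u => N u && (u != i)) x)%N.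
  rewrite /S big_mkcondl [in LHS]big_mkcond (bigD1_seq i) ?iota_uniq//= ?Ni//.
  by rewrite mem_index_iota.
case: (X i x) (X1 i x) => [|[]]//= _; first by rewrite !mul0r.
by rewrite add1n addnS.
Qed.

Lemma ld_first_order :
  `|E (fun x => (W x)%:R * dg (W x)) - ldmean * E (fun x => dg (W x).+1)|
  <= 2 * D * ld2.
Proof.
have -> : ldmean = \sum_(1 <= i < m.+1) e1 i.
  by rewrite -pexp_sum; apply: eq_pexp => x; rewrite natr_sum.
have -> : E (fun x => (W x)%:R * dg (W x)) =
    \sum_(1 <= i < m.+1) E (fun x => (X i x)%:R * dg (W x)).
  rewrite -pexp_sum; apply: eq_pexp => x; rewrite natr_sum mulr_suml; exact: eq_bigr.
rewrite mulr_suml -sumrB mulr_sumr.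
apply: (le_trans (ler_norm_sum _ _ _)); apply: ler_sum_nat => i im.
have nii : close_to r i i by rewrite /close_to leq_addr.
under eq_pexp do rewrite (X_absorb _ dg im nii).
apply: (@pexp_approx (fun j => dg j.+1) D (close_to r i)
  (fun u => close_to r i u && (u != i)) _ (A i)) => //.
  by move=> j; exact: gD.
by move=> u; exact: Afar.
Qed.

Let near_r2 i j u : close_to r i j -> ~~ close_to (r + r) i u -> ~~ close_to r j u.
Proof. rewrite /close_to; lia. Qed.

(** The left-hand side is the argument reached by the telescoping sum just
  before [j]; the right-hand side separates its part independent of
  [(X i, X j)]. *)
Let partial_far i j x (C : pred nat) :
  (1 <= j < m.+1)%N -> close_to r i j ->
  (S (predC (close_to r i)) x + \sum_(1 <= u < j | close_to r i u && C u) X u x)%N =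
  (S (predC (close_to (r + r) i)) x
   + S (fun u => close_to (r + r) i u && ((u < j) || ~~ close_to r i u)
                && (close_to r i u ==> C u)) x)%N.
Proof.
move=> jm nij; rewrite (big_nat_widen 1 j m.+1)//; last by lia.
have SD P Q : (S P x + S Q x = \sum_(1 <= u < m.+1) (P u + Q u) * X u x)%N.
  rewrite /S [X in (X + _)%N]big_mkcond [X in (_ + X)%N]big_mkcond -big_split.
  by apply: eq_bigr => u _; case: (P u); case: (Q u) => /=; lia.
have := SD (predC (close_to r i)) (fun u => (close_to r i u && C u) && (u < j)%N).
rewrite /S => ->.
have := SD (predC (close_to (r + r) i)) (fun u => close_to (r + r) i u &&
  ((u < j)%N || ~~ close_to r i u) && (close_to r i u ==> C u)); rewrite /S => ->.
apply: eq_bigr => u _; congr (_ * _)%N.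
have /= : close_to r i u -> close_to (r + r) i u by rewrite /close_to; lia.
case: (close_to r i u) => [->//|_]; last by case: (close_to (r + r) i u); rewrite /= ?orbT.
by rewrite implyTb orbF andTb andbC.
Qed.

(** Covariances vanish beyond distance [r], and [X i ^ 2 = X i] makes the
  diagonal of the second moment cancel the mean. *)
Lemma ldvar_cov :
  ldmean - ldvar =
  \sum_(1 <= i < m.+1) \sum_(1 <= j < m.+1 | close_to r i j)
     (e1 i * e1 j - (if j != i then e2 i j else 0)).
Proof.
have mE : ldmean = \sum_(1 <= i < m.+1) e1 i.
  by rewrite -pexp_sum; apply: eq_pexp => x; rewrite natr_sum.
have -> : ldvar = \sum_(1 <= i < m.+1) \sum_(1 <= j < m.+1) (e2 i j - e1 i * e1 j).
  rewrite /ldvar (_ : E _ = E (fun x => (W x)%:R ^+ 2) - ldmean ^+ 2); last first.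
    transitivity (E (fun x => (W x)%:R ^+ 2 - (2 * ldmean * (W x)%:R - ldmean ^+ 2))).
      by apply: eq_pexp => x; ring.
    by rewrite !pexpB pexpZ pexp_cst -/ldmean; ring.
  have -> : E (fun x => (W x)%:R ^+ 2) =
      \sum_(1 <= i < m.+1) \sum_(1 <= j < m.+1) e2 i j.
    under [RHS]eq_bigr do rewrite -pexp_sum.
    rewrite -pexp_sum; apply: eq_pexp => x; rewrite natr_sum expr2 mulr_suml; apply: eq_bigr => i _.
    by rewrite mulr_sumr.
  rewrite mE expr2 mulr_suml -sumrB; apply: eq_bigr => i _.
  by rewrite mulr_sumr -sumrB.
rewrite mE -sumrB; apply: eq_big_nat => i im.
have nii : close_to r i i by rewrite /close_to leq_addr.
have e2ii : e2 i i = e1 i.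
  apply: eq_pexp => x; rewrite -natrM.
  by case: (X i x) (X1 i x) => [|[]].
rewrite (bigID (close_to r i))/= [X in _ - (_ + X)]big1 ?addr0; last first.
  move=> j nij; rewrite /e2 (@pexpM _ _ _ _ _ (A i)) ?subrr//.
  by apply: (@depends_onS _ _ _ (A j)); [exact: Afar|exact: natXdep].
rewrite -[X in X - _](_ : \sum_(1 <= j < m.+1 | close_to r i j)
    (if j == i then e1 i else 0) = _); last first.
  rewrite big_mkcond (bigD1_seq i) ?iota_uniq ?mem_index_iota//= nii eqxx.
  by rewrite big1 ?addr0// => j /negbTE ->; rewrite if_same.
rewrite -sumrB; apply: eq_bigr => j _.
by case: eqVneq => [->|_]/=; rewrite ?e2ii; ring.
Qed.

Lemma ldvar_bound : `|ldmean - ldvar| <= ld2.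
Proof.
rewrite ldvar_cov; apply: (le_trans (ler_norm_sum _ _ _)); apply: ler_sum => i _.
apply: (le_trans (ler_norm_sum _ _ _)).
rewrite mulr_sumr [X in _ <= X + _]big_mkcondr -big_split; apply: ler_sum => j _.
have p1 u : 0 <= e1 u by apply: pexp_ge0.
have p2 : 0 <= e2 i j by apply: pexp_ge0 => // x; rewrite mulr_ge0.
apply: (le_trans (ler_normB _ _)).
rewrite addrC; apply: lerD; last by rewrite ger0_norm ?mulr_ge0.
by case: ifP => _; rewrite ?normr0// ger0_norm.
Qed.

(** Far from [i] the summand [X i] factors out, so only the increments of [g]
  between the far part and [W] remain; telescoping writes them as sums over
  the neighbours [j] of [i], and [pexp_approx] replaces each increment by its
  mean at [W + 1]. *)
Lemma ld_second_order :
  `|ldmean * E (fun x => g (W x).+1) - E (fun x => (W x)%:R * g (W x))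
    - (ldmean - ldvar) * E (fun x => dg (W x).+1)| <= 2 * D * ld3.
Proof.
rewrite ldvar_cov.
have -> : ldmean = \sum_(1 <= i < m.+1) e1 i.
  by rewrite -pexp_sum; apply: eq_pexp => x; rewrite natr_sum.
have -> : E (fun x => (W x)%:R * g (W x)) =
    \sum_(1 <= i < m.+1) E (fun x => (X i x)%:R * g (W x)).
  rewrite -pexp_sum; apply: eq_pexp => x; rewrite natr_sum mulr_suml.
  exact: eq_bigr.
rewrite !mulr_suml -!sumrB mulr_sumr.
apply: (le_trans (ler_norm_sum _ _ _)); apply: ler_sum_nat => i im.
have nii : close_to r i i by rewrite /close_to leq_addr.
pose F1 x := S (predC (close_to r i)) x.
have -> : E (fun x => (X i x)%:R * g (W x)) =
    E (fun x => (X i x)%:R * g (F1 x + S (fun u => close_to r i u && (u != i)) x).+1).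
  by apply: eq_pexp => x; exact: X_absorb.
have far_eq : E (fun x => (X i x)%:R * g (F1 x).+1) = e1 i * E (fun x => g (F1 x).+1).
  refine (@farM _ _ (predC (close_to r i)) (fun y => g y.+1) (@natXdep i) (@Afar i)).
pose V (C : pred nat) j x := (F1 x + \sum_(1 <= u < j | close_to r i u && C u) X u x)%N.
have tel (C : pred nat) x :
    g (F1 x + S (fun u => close_to r i u && C u) x).+1 - g (F1 x).+1 =
    \sum_(1 <= j < m.+1 | close_to r i j && C j) (X j x)%:R * dg (V C j x).+1.
  pose Y u := if close_to r i u && C u then X u x else 0%N.
  have Y1 u : (Y u <= 1)%N by rewrite /Y; case: ifP.
  have := telescope_diff (fun y => g y.+1) m (F1 x) Y1.
  rewrite /S -big_mkcond /= => ->; rewrite [RHS]big_mkcond.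
  apply: eq_bigr => j _; rewrite /V /Y -big_mkcond /=.
  by case: ifP => // _; rewrite mul0r.
pose T := \sum_(1 <= j < m.+1 | close_to r i j)
  (e1 i * E (fun x => (X j x)%:R * dg (V predT j x).+1)
   - (if j != i then
      E (fun x => (X i x)%:R * (X j x)%:R * dg (V (fun u => u != i) j x).+1) else 0)).
have -> : e1 i * E (fun x => g (W x).+1) -
    E (fun x => (X i x)%:R * g (F1 x + S (fun u => close_to r i u && (u != i)) x).+1) = T.
  rewrite /T sumrB -mulr_sumr -pexp_sum -big_mkcondr -pexp_sum.
  have -> : E (fun x => \sum_(1 <= j < m.+1 | close_to r i j)
      (X j x)%:R * dg (V predT j x).+1) =
      E (fun x => g (W x).+1) - E (fun x => g (F1 x).+1).
    rewrite -pexpB; apply: eq_pexp => x; rewrite (W_split (close_to r i)).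
    have := tel predT x; rewrite /S /F1.
    have eP k : close_to r i k && predT k = close_to r i k by rewrite andbT.
    by rewrite ![\sum_(_ <= _ < _ | close_to r i _ && predT _) _](eq_bigl _ _ eP) => ->.
  have -> : E (fun x => \sum_(1 <= j < m.+1 | close_to r i j && (j != i))
      (X i x)%:R * (X j x)%:R * dg (V (fun u => u != i) j x).+1) =
      E (fun x => (X i x)%:R *
           g (F1 x + S (fun u => close_to r i u && (u != i)) x).+1) -
      e1 i * E (fun x => g (F1 x).+1).
    rewrite -far_eq -pexpB; apply: eq_pexp => x.
    by rewrite -mulrBr tel mulr_sumr; apply: eq_bigr => j _; rewrite mulrA.
  ring.
rewrite mulr_suml -sumrB mulr_sumr.
apply: (le_trans (ler_norm_sum _ _ _)).
rewrite big_nat_cond [leRHS]big_nat_cond; apply: ler_sum => j /andP[jm nij].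
pose U := fun u => close_to (r + r) i u && ((u < j)%N || ~~ close_to r i u).
pose Ed := E (fun x => dg (W x).+1).
have appr (C : pred nat) F B : (forall x, 0 <= F x) -> depends_on F B ->
    (forall u, ~~ close_to (r + r) i u -> A u \subset ~: B) ->
    `|E (fun x => F x * dg (V C j x).+1) - E F * Ed| <=
    2 * D * (\sum_(1 <= u < m.+1 | U u && (close_to r i u ==> C u))
               E (fun x => F x * (X u x)%:R)
             + E F * \sum_(1 <= u < m.+1 | close_to (r + r) i u) e1 u).
  move=> F0 FB BN.
  have <- : E (fun x => F x * dg (S (predC (close_to (r + r) i)) x +
      S (fun u => U u && (close_to r i u ==> C u)) x).+1) =
      E (fun x => F x * dg (V C j x).+1).
    apply: eq_pexp => x; congr (_ * dg _.+1).
    by rewrite -(partial_far x C jm nij).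
  exact: (@pexp_approx (fun j => dg j.+1) D (close_to (r + r) i)
    (fun u => U u && (close_to r i u ==> C u)) F B (fun j => gD j.+1) F0 FB BN).
have p1 u : 0 <= e1 u by apply: pexp_ge0.
have D0 : 0 <= D by apply: le_trans (gD 0%N).
have A1 : `|E (fun x => (X j x)%:R * dg (V predT j x).+1) - e1 j * Ed| <=
    2 * D * (\sum_(1 <= u < m.+1 | U u) e2 j u
      + e1 j * \sum_(1 <= u < m.+1 | close_to (r + r) i u) e1 u).
  have -> : \sum_(1 <= u < m.+1 | U u) e2 j u =
      \sum_(1 <= u < m.+1 | U u && (close_to r i u ==> predT u)) e2 j u.
    by apply: eq_bigl => u; rewrite implybT andbT.
  apply: (appr predT _ (A j)) => [x||u nu]; [by []|exact: natXdep|].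
  exact: (Afar (near_r2 nij nu)).
have A2 : `|E (fun x => (X i x)%:R * (X j x)%:R * dg (V (fun u => u != i) j x).+1)
    - e2 i j * Ed| <= 2 * D * (\sum_(1 <= u < m.+1 | U u && (u != i)) e3 i j u
      + e2 i j * \sum_(1 <= u < m.+1 | close_to (r + r) i u) e1 u).
  have -> : \sum_(1 <= u < m.+1 | U u && (u != i)) e3 i j u =
      \sum_(1 <= u < m.+1 | U u && (close_to r i u ==> (u != i))) e3 i j u.
    apply: eq_bigl => u; case: (eqVneq u i) => [->|_]; first by rewrite nii.
    by rewrite implybT.
  apply: (appr (fun u => u != i) _ (A i :|: A j)) => [x||u nu].
  - by rewrite mulr_ge0.
  - exact: natXXdep.
  - rewrite finset.setCU finset.subsetI (Afar (near_r2 nij nu)) Afar//.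
    by apply: contra nu; rewrite /close_to; lia.
rewrite -/Ed.
rewrite big_split /= -mulr_sumr.
have -> : \sum_(1 <= u < m.+1 | U u) (if (j != i) && (u != i) then e3 i j u else 0)
    = if j != i then \sum_(1 <= u < m.+1 | U u && (u != i)) e3 i j u else 0.
  by case: (j != i); rewrite /= -?big_mkcondr// big1.
move: A1 A2; rewrite -/Ed.
set S2 := \sum_(_ <= _ < _ | _) e2 _ _; set S3 := \sum_(_ <= _ < _ | _) e3 _ _ _.
set N2 := \sum_(_ <= _ < _ | _) e1 _ => A1 A2.
set Ej := E _ in A1 *; set Eij := E _ in A2 *.
have A1' : `|e1 i * (Ej - e1 j * Ed)| <= 2 * D * (e1 i * (S2 + e1 j * N2)).
  by rewrite normrM ger0_norm// mulrCA ler_wpM2l.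
case: ifP => _.
  rewrite (_ : _ - _ = e1 i * (Ej - e1 j * Ed) - (Eij - e2 i j * Ed)); last by ring.
  apply: (le_trans (ler_normB _ _)); apply: (le_trans (lerD A1' A2)).
  by rewrite -mulrDr ler_wpM2l// ?mulr_ge0//; lra.
rewrite (_ : _ - _ = e1 i * (Ej - e1 j * Ed)); last by ring.
apply: (le_trans A1'); rewrite ler_wpM2l ?mulr_ge0//; lra.
Qed.

(** The variance enters through [ldmean - (1 - c) * ldvar], the coefficient at
  which the first order terms of both pieces recombine. *)
Lemma ld_stein (c c0 : R) : c0 = (1 - c) * ldmean ->
  `|E (fun x => (c0 + c * (W x)%:R) * g (W x).+1 - (W x)%:R * g (W x))
    - (ldmean - (1 - c) * ldvar) * E (fun x => dg (W x).+1)|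
  <= D * (2 * (`|1 - c| * ld3 + `|c| * ld2)).
Proof.
move=> c0E.
have -> : E (fun x => (c0 + c * (W x)%:R) * g (W x).+1 - (W x)%:R * g (W x)) =
    (1 - c) * (ldmean * E (fun x => g (W x).+1) - E (fun x => (W x)%:R * g (W x)))
    + c * E (fun x => (W x)%:R * dg (W x)).
  rewrite -!pexpZ -pexpB -!pexpZ -pexpD; apply: eq_pexp => x; rewrite c0E /dg; ring.
have := ld_second_order; have := ld_first_order.
set u := E (fun x => g _.+1); set v := E _; set z := E _; set y := E _.
move=> h1 h2.
rewrite (_ : _ - _ = (1 - c) * (ldmean * u - y - (ldmean - ldvar) * z)
   + c * (v - ldmean * z)); last by ring.
apply: (le_trans (ler_normD _ _)); rewrite !normrM.
rewrite (_ : D * _ = `|1 - c| * (2 * D * ld3) + `|c| * (2 * D * ld2)); last by ring.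
by apply: lerD; apply: ler_wpM2l.
Qed.

End local_dependence.

(** * Runs of failures followed by successes *)

Section runs_in_product.
Variables (k1 k2 n : nat).
Local Notation k := (k1 + k2)%N.

Definition trial_at (i : nat) (x : {ffun 'I_n -> bool}) : bool :=
  if insub i.-1 is Some c then x c else false.

Definition run_pattern (i c : nat) (b : bool) : bool :=
  if (c < i + k1)%N then ~~ b else b.

Lemma runI_pattern (T : Type) (eta : nat -> T -> bool) i t :
  (1 <= i <= n - k)%N ->
  runI k1 k2 n eta i t =
  (trial eta (i - 1) t * (\prod_(i <= c < i + k) run_pattern i c (eta c t))
   * ~~ eta (i + k) t)%N.
Proof.
move=> im; rewrite /runI im; congr (_ * _ * _)%N; last first.
  rewrite /trial; have -> : (i + k = (i + k).-1.+1)%N by lia.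
  by rewrite /=; case: (eta _ _).
rewrite [RHS](@big_cat_nat _ _ _ (i + k1)) ?leq_addr ?leq_add2l ?leq_addr//=.
have trialE c : (1 <= c)%N -> trial eta c t = eta c t by case: c.
have shift a l (F : nat -> nat) :
    (\prod_(a <= c < a + l) F c = \prod_(1 <= j < l.+1) F (a + j - 1))%N.
  rewrite -{1}[a]add0n big_addn big_add1 addKn /=.
  by apply: eq_bigr => j _; congr F; lia.
rewrite addnA (shift i k1) (shift (i + k1)%N k2).
congr (_ * _)%N; apply: eq_big_nat => j /andP[j1 jk]; rewrite trialE ?/run_pattern; try lia.
  by case: ifPn; [case: (eta _ _)|lia].
by case: ifPn; [lia|].
Qed.

Lemma runI_le1 (T : Type) (eta : nat -> T -> bool) l t :
  (runI k1 k2 n eta l t <= 1)%N.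
Proof.
case: l => [i|]//; case im: (1 <= i <= n - k)%N; last by rewrite /= im.
rewrite runI_pattern//.
have tr1 c : (trial eta c t <= 1)%N by case: c => //= c; case: (eta _ _).
rewrite -[1%N]/(1 * 1 * 1)%N !leq_mul ?leq_b1//.
elim/big_ind : _ => //= [x y x1 y1|c _]; last by rewrite leq_b1.
exact: (leq_mul x1 y1).
Qed.

Lemma runI_eq (T T' : Type) (eta : nat -> T -> bool) (eta' : nat -> T' -> bool)
    l t t' :
  (forall c, (1 <= c <= n)%N -> l <= c%:Z + 1 -> c%:Z <= l + k%:Z ->
    eta c t = eta' c t') ->
  runI k1 k2 n eta l t = runI k1 k2 n eta' l t'.
Proof.
case: l => [i|]// H; case im: (1 <= i <= n - k)%N; last by rewrite /= im.
rewrite !runI_pattern//; congr (_ * _ * nat_of_bool (~~ _))%N.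
- case: i im H => [|[|i]]// im H; rewrite subn1 /=; congr nat_of_bool.
  by apply: H; lia.
- by apply: eq_big_nat => c ck; congr (nat_of_bool (run_pattern _ _ _)); apply: H; lia.
- by apply: H; lia.
Qed.

(** If two runs start less than [k] apart, the success that precedes the later
  one falls in the success block of the earlier one; so does then the first
  failure of the later one, which is impossible. *)
Lemma runI_overlap (T : Type) (eta : nat -> T -> bool) (i j : nat) t :
  (1 <= k1)%N -> (1 <= k2)%N -> (i < j < i + k)%N ->
  (runI k1 k2 n eta i t * runI k1 k2 n eta j t = 0)%N.
Proof.
move=> k1p k2p ij.
case im: (1 <= i <= n - k)%N; last by rewrite [X in (X * _)%N]/= im.
case jm: (1 <= j <= n - k)%N; last by rewrite [X in (_ * X)%N]/= jm muln0.
rewrite !runI_pattern//.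
have kill (a l : nat) (f : nat -> bool) c : (a <= c < l)%N -> f c = false ->
    (\prod_(a <= c < l) f c = 0)%N.
  move=> ac fc; rewrite (bigD1_seq c) ?iota_uniq ?mem_index_iota//=.
  by rewrite fc mul0n.
have -> : trial eta (j - 1)%N t = eta (j - 1)%N t.
  have : (0 < j - 1)%N by lia.
  by case: (j - 1)%N.
case ej1 : (eta (j - 1)%N t); last by rewrite !mul0n muln0.
case: (ltnP (j - 1) (i + k1)) => jik.
  rewrite (@kill i (i + k)%N _ (j - 1)%N) ?muln0 ?mul0n//; first by lia.
  by rewrite /run_pattern jik ej1.
case ej : (eta j t).
  rewrite (@kill j (j + k)%N _ j) ?muln0 ?mul0n ?muln0//; first by lia.
  by rewrite /run_pattern ej ifT//; lia.
rewrite (@kill i (i + k)%N _ j) ?muln0 ?mul0n//; first by lia.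
by rewrite /run_pattern ej ifF//; lia.
Qed.

End runs_in_product.

Section iid_runs.
Variables (R : realType) (k1 k2 n : nat).
Local Notation k := (k1 + k2)%N.
Local Notation m := (n - k)%N.

Lemma trial_atE c (x : {ffun 'I_n -> bool}) (cn : (c.-1 < n)%N) :
  trial_at c x = x (Ordinal cn).
Proof. by rewrite /trial_at insubT. Qed.

(** Coordinate [c] of the product space carries the trial [c.+1]. *)
Definition window lo hi : {set 'I_n} := 
  [set c : 'I_n | (lo <= c.+1 < hi)%N]%SET.

Lemma trial_at_window lo hi c :
  (1 <= c <= n)%N -> (lo <= c < hi)%N -> depends_on (@trial_at n c) (window lo hi).
Proof.
move=> c1 clh x y xy; have cn : (c.-1 < n)%N by lia.
by rewrite !trial_atE; apply: xy; rewrite inE /=; lia.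
Qed.

Lemma pexp_window (ps : nat -> R) (f : nat -> bool -> R) lo hi :
  (1 <= lo)%N -> (hi <= n.+1)%N ->
  pexp (fun i : 'I_n => ps i.+1)
    (fun x => \prod_(lo <= c < hi) f c (trial_at c x)) =
  \prod_(lo <= c < hi) (ps c * f c true + (1 - ps c) * f c false).
Proof.
move=> lo1 hin.
pose f' (i : 'I_n) b := if (lo <= i.+1 < hi)%N then f i.+1 b else 1.
have E (g : nat -> R) : \prod_(lo <= c < hi) g c =
    \prod_(i < n) (if (lo <= i.+1 < hi)%N then g i.+1 else 1).
  rewrite -(big_mkord xpredT (fun i => if (lo <= i.+1 < hi)%N then g i.+1 else 1)).
  rewrite -(big_add1 _ _ 0 n.+1 xpredT (fun i => if (lo <= i < hi)%N then g i else 1)).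
  rewrite -big_mkcond /= [LHS]big_nat_cond (big_nat_widen _ _ n.+1)//.
  rewrite (big_nat_widenl _ 1)//; apply: eq_bigl => c; lia.
transitivity (pexp (fun i : 'I_n => ps i.+1) (fun x => \prod_i f' i (x i))).
  apply: eq_pexp => x; rewrite E; apply: eq_bigr => i _; rewrite /f'.
  by case: ifP => // _; rewrite (@trial_atE i.+1 x (ltn_ord i)); congr (f _ (x _)); apply: val_inj.
rewrite pexp_prod_coord E; apply: eq_bigr => i _; rewrite /f'; case: ifP => // _.
by ring.
Qed.

Definition runX (i : nat) (x : {ffun 'I_n -> bool}) : nat :=
  runI k1 k2 n (@trial_at n) i x.

Lemma runX_dep i : depends_on (runX i) (window (i - 1) (i + k).+1).
Proof.
move=> x y xy; apply: runI_eq => c cn ci ck.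
by apply: trial_at_window xy => //; lia.
Qed.

Lemma window_far a b c d : (b <= c)%N || (d <= a)%N ->
  window c d \subset ~: window a b.
Proof. by move=> H; apply/fintype.subsetP => i; rewrite !inE; lia. Qed.

Lemma runX_far i j : ~~ close_to k.+1 i j ->
  window (j - 1) (j + k).+1 \subset ~: window (i - 1) (i + k).+1.
Proof. by move=> nij; apply: window_far; move: nij; rewrite /close_to; lia. Qed.

Variable p : R.
Hypothesis p01 : 0 < p < 1.
Hypotheses (k1p : (1 <= k1)%N) (k2p : (1 <= k2)%N).

Local Notation E := (pexp (fun _ : 'I_n => p)).
Local Notation ap := (arun k1 k2 p).

Let block i (x : {ffun 'I_n -> bool}) : R :=
  \prod_(i <= c < i + k) (run_pattern k1 i c (trial_at c x))%:R.

Let pp : forall i : 'I_n, 0 <= p <= 1.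
Proof. by move=> _; case/andP: p01 => p0 p1; rewrite !ltW. Qed.

Let block_ge0 i x : 0 <= block i x.
Proof. exact: prodr_ge0. Qed.

Let ap_ge0 : 0 <= ap.
Proof.
by case/andP: p01 => p0 p1; rewrite /arun mulr_ge0// exprn_ge0 ?subr_ge0 ?ltW.
Qed.

Lemma pexp_block i : (1 <= i <= m)%N -> E (block i) = ap.
Proof.
move=> im.
rewrite (@pexp_window (fun=> p) (fun c b => (run_pattern k1 i c b)%:R)); try lia.
rewrite (@big_cat_nat _ _ _ (i + k1)) ?leq_addr ?leq_add2l ?leq_addr//=.
rewrite /arun /run_pattern; congr (_ * _).
  under eq_big_nat => c /andP[_ ck]. rewrite ck /= mulr0 mulr1 add0r. over.
  by rewrite prodr_const_nat addKn.
rewrite (eq_big_nat _ _ (F2 := fun=> p)).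
  by rewrite prodr_const_nat addnA addKn.
by move=> c /andP[ic _]; rewrite ltnNge ic /= mulr1 mulr0 addr0.
Qed.

Lemma runX_le_block i x : (runX i x)%:R <= block i x.
Proof.
rewrite /runX; case im: (1 <= i <= m)%N; last by rewrite /runI im.
rewrite runI_pattern// !natrM natr_prod -[leRHS]mul1r -[leRHS]mulr1.
have t1 : ((trial (@trial_at n) (i - 1) x)%:R : R) <= 1.
  by rewrite (_ : 1 = 1%:R)// ler_nat; case: (i - 1)%N => //= c; case: trial_at.
by rewrite ler_pM ?mulr_ge0 ?prodr_ge0// ?ler_wpM2r ?prodr_ge0//; case: (~~ _).
Qed.

Let block_dep i : (1 <= i <= m)%N -> depends_on (block i) (window i (i + k)).
Proof.
move=> im x y xy; apply: eq_big_nat => c ck; congr (nat_of_bool (run_pattern _ _ _ _))%:R.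
by apply: trial_at_window xy => //; lia.
Qed.

Lemma pexp_trial_at c (f : bool -> R) : (1 <= c <= n)%N ->
  E (fun x => f (trial_at c x)) = p * f true + (1 - p) * f false.
Proof.
move=> cn; have := @pexp_window (fun=> p) (fun=> f) c c.+1.
rewrite big_nat1 => <-; [|lia..].
by apply: eq_pexp => x; rewrite big_nat1.
Qed.

(** The trials next to the block contribute the factor [p * (1 - p) <= 1 / 4],
  except for the first run, whose left neighbour is the sure success of
  index 0. *)
Lemma pexp_runX i : (1 <= i <= m)%N ->
  E (fun x => (runX i x)%:R) <= ap / 4 + (if i == 1%N then 3 / 4 * ap else 0).
Proof.
move=> im; case: eqVneq => i1.
  rewrite (_ : _ + _ = E (block i)); last by rewrite pexp_block//; lra.
  by apply: le_pexp => // x; exact: runX_le_block.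
have -> : E (fun x => (runX i x)%:R) =
    E (fun x => (trial_at (i - 1) x)%:R * (block i x * (~~ trial_at (i + k) x)%:R)).
  apply: eq_pexp => x; rewrite /runX runI_pattern// !natrM natr_prod mulrA.
  have : (0 < i - 1)%N by lia.
  by case: (i - 1)%N.
rewrite (@pexpM _ _ _ _ _ (window (i - 1) i)); first last.
- move=> x y xy; congr (_ * (nat_of_bool (~~ _))%:R).
    by apply: (block_dep im) => c cw; apply: xy; move: cw; rewrite !inE; lia.
  apply: (@trial_at_window i (i + k).+1) => [||c cw]; [lia..|].
  by apply: xy; move: cw; rewrite !inE; lia.
- by move=> x y xy; congr (nat_of_bool _)%:R; apply: trial_at_window xy; lia.
rewrite (@pexpM _ _ _ _ _ (window i (i + k))); first last.
- move=> x y xy; congr (nat_of_bool (~~ _))%:R.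
  apply: (@trial_at_window (i + k) (i + k).+1) => [||c cw]; [lia..|].
  by apply: xy; move: cw; rewrite !inE; lia.
- exact: block_dep.
rewrite pexp_block// (@pexp_trial_at _ (fun b => b%:R)) ?(@pexp_trial_at _ (fun b => (~~ b)%:R)); try lia.
rewrite (_ : _ * _ = ap * (p * (1 - p))) /=; last by ring.
rewrite addr0 ler_wpM2l//.
by have := sqr_ge0 (p - 1 / 2); rewrite expr2; lra.
Qed.

Definition far_enough (i j : nat) := (i + k <= j)%N || (j + k <= i)%N.

Let XX0 i j x : ~~ far_enough i j -> i != j -> (runX i x * runX j x = 0)%N.
Proof.
rewrite /far_enough => fij ij; have [lt|lt] : (i < j < i + k)%N \/ (j < i < j + k)%N by lia.
  exact: runI_overlap.
by rewrite mulnC; exact: runI_overlap.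
Qed.

(** Blocks of runs at distance at least [k] use disjoint sets of trials. *)
Lemma pexp_runX2 i j : (1 <= i <= m)%N -> (1 <= j <= m)%N -> i != j ->
  E (fun x => (runX i x)%:R * (runX j x)%:R) <= if far_enough i j then ap ^+ 2 else 0.
Proof.
move=> im jm ij; case: ifPn => [fij|nij]; last first.
  rewrite -[leRHS](pexp_cst (fun _ : 'I_n => p) 0); apply: le_pexp => // x.
  by rewrite -natrM XX0.
rewrite expr2 -{1}(pexp_block im) -(pexp_block jm).
rewrite -(@pexpM _ _ _ _ _ (window i (i + k))); first last.
- by apply: (depends_onS _ (block_dep jm)); apply: window_far; move: fij; rewrite /far_enough; lia.
- exact: block_dep.
by apply: le_pexp => // x; rewrite ler_pM// runX_le_block.
Qed.

Lemma pexp_runX3 i j u : (1 <= i <= m)%N -> (1 <= j <= m)%N -> (1 <= u <= m)%N ->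
  i != j -> i != u -> j != u ->
  E (fun x => (runX i x)%:R * (runX j x)%:R * (runX u x)%:R)
  <= if far_enough i j then ap ^+ 3 else 0.
Proof.
move=> im jm um ij iu ju; case: ifPn => [fij|nij]; last first.
  rewrite -[leRHS](pexp_cst (fun _ : 'I_n => p) 0); apply: le_pexp => // x.
  by rewrite -natrM XX0// mul0r.
have E0 : (forall x, (runX i x * runX j x * runX u x = 0)%N) ->
    E (fun x => (runX i x)%:R * (runX j x)%:R * (runX u x)%:R) <= ap ^+ 3.
  move=> H; apply: (@le_trans _ _ 0); last by rewrite exprn_ge0.
  rewrite -[leRHS](pexp_cst (fun _ : 'I_n => p) 0); apply: le_pexp => // x.
  by rewrite -!natrM H.
have [fiu|niu] := boolP (far_enough i u); last first.
  by apply: E0 => x; rewrite -mulnA mulnCA XX0// muln0.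
have [fju|nju] := boolP (far_enough j u); last first.
  by apply: E0 => x; rewrite -mulnA XX0// muln0.
rewrite exprSr expr2 -{1}(pexp_block im) -{1}(pexp_block jm) -(pexp_block um).
rewrite -(@pexpM _ _ _ _ _ (window i (i + k))); first last.
- by apply: (depends_onS _ (block_dep jm)); apply: window_far; move: fij; rewrite /far_enough; lia.
- exact: block_dep.
rewrite -(@pexpM _ _ _ _ _ (window i (i + k) :|: window j (j + k))); first last.
- apply: (depends_onS _ (block_dep um)); rewrite finset.setCU finset.subsetI.
  by rewrite !window_far//; move: fju fiu; rewrite /far_enough; lia.
- by move=> x y xy; congr (_ * _); apply: block_dep => // c cw; apply: xy; rewrite inE cw ?orbT.
apply: le_pexp => // x.
by rewrite ler_pM ?mulr_ge0 ?runX_le_block// ler_pM ?runX_le_block.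
Qed.

End iid_runs.

(** * Moments of runs of i.i.d. trials *)

Section constants_bounds.
Variable R : realType.

Section bounds.
Variables (k n : nat) (p : R).
Local Notation K := (k%:R : R).
Local Notation N := (n%:R : R).
Hypotheses (K2 : 2 <= K) (KN : 5 * K <= N) (p0 : 0 < p) (p1 : p < 1).

(* [lra] reads the hypotheses of the goal, but not the section hypotheses *)
Local Ltac facts := move: K2 KN p0 p1 => ? ? ? ?.

Lemma dstar_ge1 : 1 <= dstar p.
Proof.
facts; rewrite /dstar; have : 0 <= (1 - p) * p by rewrite mulr_ge0 ?subr_ge0 ?ltW.
lra.
Qed.

Let pow0 (x : R) e : 0 <= x -> 0 <= x ^+ e. Proof. exact: exprn_ge0. Qed.
Let powV (x y : R) e f : 0 <= x -> 0 <= y -> 0 <= x ^+ e / y ^+ f.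
Proof. by move=> x0 y0; rewrite divr_ge0 ?pow0. Qed.
Let K10 : 0 <= K + 1. Proof. facts; lra. Qed.
Let K20 : 0 <= K + 2. Proof. facts; lra. Qed.
Let Kd0 : 0 <= (K + 1) / (K + 2). Proof. by rewrite divr_ge0. Qed.

Lemma c1_ge : (N - 2 * K - 2) * (K + 1) <= c1 R n k.
Proof. by rewrite /c1 lerDl powV. Qed.

Lemma c2_ge : N - 3 * K <= c2 R n k.
Proof. by rewrite /c2 lerDl mulr_ge0// pow0. Qed.

Lemma c3_ge : N - 5 * K <= c3 R n k.
Proof.
facts; rewrite /c3 lerDl mulr_ge0 ?powV// mulr_ge0//; nra.
Qed.

Lemma c4_ge0 : 0 <= c4 R n k.
Proof.
facts; rewrite /c4; apply: addr_ge0; first by rewrite !expr2; nra.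
by rewrite mulr_ge0 ?pow0// expr2; nra.
Qed.

Lemma c5_ge0 : 0 <= c5 R n k.
Proof.
facts; rewrite /c5; apply: addr_ge0; first by rewrite !expr2; nra.
by rewrite mulr_ge0 ?powV//; nra.
Qed.

(** The powers in the constants [c1] to [c5] are nonnegative and [dstar] is at
  least 1; dropping the former and replacing the latter by 1 leaves a
  polynomial in [n] and [k]. *)
Lemma h1_ge :
  (N - K) * (10 + 5 * K + (3 * K ^+ 2 + 11 * K + 10) / 2)
  + (3 + (4 * K + 7) / 2) * ((N - 2 * K - 2) * (K + 1)) + (K + 4) * (N - 3 * K)
  <= h1 n k p.
Proof.
facts; have d1 := dstar_ge1; rewrite /h1.
have grow A u : 0 <= A -> 0 <= u -> A + u <= dstar p * (A + u * dstar p).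
  move=> A0 u0; have ud : u <= u * dstar p by rewrite ler_peMr.
  by apply: (@le_trans _ _ (A + u * dstar p)); [lra|rewrite ler_peMl//; lra].
have D1 : 6 + 5 * K + (3 * K ^+ 2 + 11 * K + 10) / 2 <= delta1 k p.
  rewrite /delta1 (addrC 6); apply: grow; first lra.
  by rewrite divr_ge0// expr2; nra.
have D2 : 3 + (4 * K + 7) / 2 <= delta2 k p.
  by apply: grow; lra.
have D : K + 4 <= delta k p.
  by rewrite /delta; set d := dstar p in d1 *; nra.
have H c d c' d' : 0 <= c -> 0 <= d -> c <= c' -> d <= d' -> c * d <= c' * d' :> R.
  by move=> *; apply: ler_pM.
have T1 : (N - K) * (10 + 5 * K + (3 * K ^+ 2 + 11 * K + 10) / 2) <=
    (N - K) * (4 + delta1 k p).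
  by apply: ler_wpM2l; lra.
have T2 : (3 + (4 * K + 7) / 2) * ((N - 2 * K - 2) * (K + 1)) <=
   delta2 k p * c1 R n k.
  by apply: H D2 c1_ge; nra.
have T3 : (K + 4) * (N - 3 * K) <= delta k p * c2 R n k.
  by apply: H D c2_ge; nra.
have T4 := c3_ge.
have T5 : 0 <= dstar p * c4 R n k by rewrite mulr_ge0 ?c4_ge0//; lra.
have T6 : 0 <= dstar p ^+ 2 / 2 * c5 R n k.
  by rewrite mulr_ge0 ?c5_ge0// divr_ge0 ?sqr_ge0.
lra.
Qed.

Lemma h2_ge :
  (N - K) * (K + 4) + (N - 2 * K - 2) * (K + 1) + (N - 3 * K) <= h2 n k p.
Proof.
facts; have d1 := dstar_ge1; rewrite /h2.
have D : K + 4 <= delta k p.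
  by rewrite /delta; set d := dstar p in d1 *; nra.
have := c1_ge; have := c2_ge.
have : (N - K) * (K + 4) <= (N - K) * delta k p by apply: ler_wpM2l; lra.
have : c1 R n k <= dstar p * c1 R n k.
  by apply: ler_peMl => //; apply: le_trans c1_ge; nra.
lra.
Qed.

(** Results of counting the neighbours in [ld2] and [ld3], in units of
  [arun ^ 2] and [arun ^ 3]. *)
Definition iid_ld2_bound : R := (N - K + 3) * (K + 3) / 8 + 4 * (N - K).
Definition iid_ld3_bound : R :=
  (N - K + 3) / 4 * ((2 * K + 3) * (4 * K + 5) + (K + 3) * (K + 2) / 2)
  + (N - K) * (20 * K + 28).

Let twoqp : 2 <= 2 + (1 - p) * p.
Proof. by rewrite lerDl mulr_ge0 ?subr_ge0 ?ltW. Qed.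

Lemma iid_ld2_bound_le : iid_ld2_bound <= (2 + (1 - p) * p) * h2 n k p.
Proof.
facts; have h := h2_ge; apply: (@le_trans _ _ (2 * h2 n k p)); last first.
  apply: ler_wpM2r => //; apply: le_trans h; nra.
rewrite /iid_ld2_bound; nra.
Qed.

Lemma iid_ld3_bound_le : iid_ld3_bound <= (2 + (1 - p) * p) * h1 n k p.
Proof.
facts; have h := h1_ge; apply: (@le_trans _ _ (2 * h1 n k p)); last first.
  apply: ler_wpM2r => //; apply: le_trans h.
  rewrite !addr_ge0 ?mulr_ge0//; try (by rewrite ?expr2; nra).
apply: le_trans (ler_wpM2l (ler0n R 2) h).
rewrite /iid_ld3_bound.
(* in the variables N - 5 K and K - 2 the difference of the two sides is a
   polynomial with nonnegative coefficients *)
have [s [s0 ->]] : exists s : R, 0 <= s /\ N = 5 * K + s.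
  by exists (N - 5 * K); split; lra.
have [t [t0 ->]] : exists t : R, 0 <= t /\ K = 2 + t.
  by exists (K - 2); split; lra.
have tt := mulr_ge0 t0 t0; have ttt := mulr_ge0 tt t0.
have ts := mulr_ge0 t0 s0; have tts := mulr_ge0 t0 ts.
rewrite expr2; lra.
Qed.

End bounds.
End constants_bounds.

Section iid_runs_bounds.
Variables (R : realType) (k1 k2 n : nat) (p : R).
Hypotheses (p01 : 0 < p < 1) (k1p : (1 <= k1)%N) (k2p : (1 <= k2)%N).
Hypothesis nk : (k1 + k2 <= n)%N.
Local Notation k := (k1 + k2)%N.
Local Notation m := (n - k)%N.
Local Notation ap := (arun k1 k2 p).
Local Notation ps := (fun _ : 'I_n => p).
Local Notation X := (@runX k1 k2 n).
Local Notation E := (pexp ps).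

Lemma sum_le_cover (P : pred nat) (s : seq nat) (c : R) : 0 <= c ->
  (forall u, (1 <= u < m.+1)%N -> P u -> u \in s) ->
  \sum_(1 <= u < m.+1 | P u) c <= (size s)%:R * c.
Proof.
move=> c0 sub; rewrite -big_filter big_const_seq iter_addr_0 count_predT.
rewrite -[leLHS]mulr_natl ler_wpM2r// ler_nat.
apply: uniq_leq_size => [|u]; first by rewrite filter_uniq ?iota_uniq.
by rewrite mem_filter mem_index_iota => /andP[Pu um]; exact: sub.
Qed.

Let ap_ge0 : 0 <= ap.
Proof.
by case/andP: p01 => p0 p1; rewrite /arun mulr_ge0// exprn_ge0 ?subr_ge0 ?ltW.
Qed.

(** The summand 3 accounts for the first run, whose mean is bounded by [ap]
  instead of [ap / 4]. *)
Lemma sum_mean_runX (P : pred nat) (s : seq nat) :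
  (forall u, (1 <= u < m.+1)%N -> P u -> u \in s) ->
  \sum_(1 <= u < m.+1 | P u) E (fun x => (X u x)%:R) <=
  ((size s)%:R + 3) / 4 * ap.
Proof.
move=> sub.
have a4 : 0 <= ap / 4 by rewrite divr_ge0.
apply: (@le_trans _ _ (\sum_(1 <= u < m.+1 | P u) ap / 4 +
    \sum_(1 <= u < m.+1 | P u && (u == 1%N)) 3 / 4 * ap)).
  rewrite [X in _ <= _ + X]big_mkcondr -big_split /= big_nat_cond [leRHS]big_nat_cond.
  by apply: ler_sum => u /andP[um _]; exact: pexp_runX.
have -> : ((size s)%:R + 3) / 4 * ap = (size s)%:R * (ap / 4) + 1 * (3 / 4 * ap).
  by field.
apply: lerD; first exact: sum_le_cover.
apply: (@sum_le_cover _ [:: 1%N]); first by rewrite mulr_ge0.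
by move=> u _ /andP[_ /eqP ->].
Qed.

Let close_cover s i u : close_to s i u -> u \in index_iota (i - s) (i - s + (s + s).+1).
Proof. by rewrite mem_index_iota /close_to; lia. Qed.

Let sum_close s i (P : pred nat) (c : R) : 0 <= c -> (forall u, P u -> close_to s i u) ->
  \sum_(1 <= u < m.+1 | P u) c <= (2 * s%:R + 1) * c.
Proof.
move=> c0 sub.
have := @sum_le_cover P (index_iota (i - s) (i - s + (s + s).+1)) c c0
  (fun u _ Pu => close_cover (sub u Pu)).
by rewrite size_iota addKn -[(s + s).+1]addn1 !natrD (_ : _ + _ = 2 * s%:R + 1)//; ring.
Qed.

Let sum_mean_close s i :
  \sum_(1 <= u < m.+1 | close_to s i u) E (fun x => (X u x)%:R) <=
  (s%:R + 2) / 2 * ap.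
Proof.
have := @sum_mean_runX (close_to s i) (index_iota (i - s) (i - s + (s + s).+1))
  (fun u _ Pu => close_cover Pu).
rewrite size_iota addKn -[(s + s).+1]addn1 !natrD.
by rewrite (_ : _ / 4 = (s%:R + 2) / 2)//; field.
Qed.

(** A run compatible with the one at [i] and within distance [k + 1] of it
  starts at [i + k], [i + k + 1] or at one of their mirror images. *)
Let sum_close_far i (c : R) : 0 <= c ->
  \sum_(1 <= j < m.+1 | close_to k.+1 i j && (j != i))
     (if far_enough k1 k2 i j then c else 0) <= 4 * c.
Proof.
move=> c0; rewrite -big_mkcondr.
apply: (@sum_le_cover _ [:: (i + k)%N; (i + k).+1; (i - k)%N; (i - k.+1)%N]) => // u um.
by rewrite /close_to /far_enough !inE; lia.
Qed.

Let E0 F : (forall x, 0 <= F x) -> 0 <= E F.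
Proof. by apply: pexp_ge0 => _; case/andP: p01 => p0 p1; rewrite !ltW. Qed.

Lemma sum_mean_all : \sum_(1 <= i < m.+1) E (fun x => (X i x)%:R) <=
  (n%:R - k%:R + 3) / 4 * ap.
Proof.
have := @sum_mean_runX predT (index_iota 1 m.+1).
rewrite size_iota subn1 /= natrB// => H.
by apply: H => u um _; rewrite mem_index_iota.
Qed.

Let sum_cst (c : R) : \sum_(1 <= i < m.+1) c = (n%:R - k%:R) * c.
Proof. by rewrite big_const_nat iter_addr_0 -natrB// subn1 mulr_natl. Qed.

Lemma iid_ld2 : ld2 ps m k.+1 X <= iid_ld2_bound R k n * ap ^+ 2.
Proof.
rewrite /ld2.
apply: (@le_trans _ _ (\sum_(1 <= i < m.+1) (4 * ap ^+ 2
    + E (fun x => (X i x)%:R) * ((k%:R + 3) / 2 * ap)))).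
  apply: ler_sum_nat => i im; apply: lerD.
    apply: le_trans (sum_close_far i (exprn_ge0 2 ap_ge0)).
    rewrite big_nat_cond [leRHS]big_nat_cond; apply: ler_sum => j /andP[jm /andP[_ ij]].
    by apply: pexp_runX2; rewrite // eq_sym.
  apply: ler_wpM2l; first exact: E0.
  by have := sum_mean_close k.+1 i; rewrite -natr1 -[_ + 1 + 2]addrA (_ : 1 + 2 = 3)//; lra.
rewrite big_split /= sum_cst -mulr_suml.
have Q0 : 0 <= (k%:R + 3) / 2 * ap by rewrite mulr_ge0 ?divr_ge0 ?addr_ge0.
apply: (le_trans (lerD (lexx _) (ler_wpM2r Q0 sum_mean_all))).
by rewrite /iid_ld2_bound le_eqVlt; apply/orP; left; apply/eqP; field.
Qed.

Lemma iid_ld3 : ld3 ps m k.+1 X <= iid_ld3_bound R k n * ap ^+ 3.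
Proof.
rewrite /ld3.
set e1 := fun i => E (fun x => (X i x)%:R).
have e10 i : 0 <= e1 i by exact: E0.
have a2 : 0 <= ap ^+ 2 by rewrite exprn_ge0.
have a3 : 0 <= ap ^+ 3 by rewrite exprn_ge0.
pose K : R := k%:R; have K0 : 0 <= K by [].
have K2 : 2 * (k.+1 + k.+1)%:R + 1 = 4 * K + 5 by rewrite natrD -natr1 /K; ring.
have K3 : ((k.+1 + k.+1)%:R + 2) / 2 = K + 2 by rewrite natrD -natr1 /K; field.
have bound_j i j : (1 <= i < m.+1)%N -> (1 <= j < m.+1)%N -> close_to k.+1 i j ->
    (\sum_(1 <= u < m.+1 | close_to (k.+1 + k.+1) i u &&
                           ((u < j)%N || ~~ close_to k.+1 i u))
       (e1 i * E (fun x => (X j x)%:R * (X u x)%:R) +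
        (if (j != i) && (u != i)
         then E (fun x => (X i x)%:R * (X j x)%:R * (X u x)%:R) else 0)) +
     (e1 i * e1 j +
      (if j != i then E (fun x => (X i x)%:R * (X j x)%:R) else 0)) *
     \sum_(1 <= u < m.+1 | close_to (k.+1 + k.+1) i u) e1 u)
    <= e1 i * ((4 * K + 5) * ap ^+ 2) + e1 i * e1 j * ((K + 2) * ap)
       + (if j != i then if far_enough k1 k2 i j
            then (4 * K + 5) * ap ^+ 3 + (K + 2) * ap ^+ 3 else 0 else 0).
  move=> im jm cij.
  pose c3 := if j != i then if far_enough k1 k2 i j then ap ^+ 3 else 0 else 0.
  pose c2 := if j != i then if far_enough k1 k2 i j then ap ^+ 2 else 0 else 0.
  have c30 : 0 <= c3 by rewrite /c3; case: ifP => // _; case: ifP.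
  have c20 : 0 <= c2 by rewrite /c2; case: ifP => // _; case: ifP.
  have A : \sum_(1 <= u < m.+1 | close_to (k.+1 + k.+1) i u &&
                           ((u < j)%N || ~~ close_to k.+1 i u))
       (e1 i * E (fun x => (X j x)%:R * (X u x)%:R) +
        (if (j != i) && (u != i)
         then E (fun x => (X i x)%:R * (X j x)%:R * (X u x)%:R) else 0))
      <= (4 * K + 5) * (e1 i * ap ^+ 2 + c3).
    have c0 : 0 <= e1 i * ap ^+ 2 + c3 by rewrite addr_ge0// mulr_ge0.
    rewrite -K2.
    apply: le_trans (@sum_close (k.+1 + k.+1) i
      (fun u => close_to (k.+1 + k.+1) i u && ((u < j)%N || ~~ close_to k.+1 i u))
      _ c0 (fun u H => proj1 (andP H))).
    rewrite big_nat_cond [leRHS]big_nat_cond; apply: ler_sum => u /andP[um /andP[_ uj]].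
    have ju : j != u by apply/eqP => e; move: uj; rewrite -e cij ltnn.
    apply: lerD.
      apply: ler_wpM2l => //; apply: (le_trans (pexp_runX2 p01 k1p k2p jm um ju)).
      by case: ifP.
    rewrite /c3; case: (eqVneq j i) => //= ji; case: eqVneq => [_|ui]/=; first by case: ifP.
    by apply: pexp_runX3; rewrite // eq_sym.
  have B : (if j != i then E (fun x => (X i x)%:R * (X j x)%:R) else 0) <= c2.
    rewrite /c2; case: ifP => // ji.
    by apply: pexp_runX2; rewrite // eq_sym.
  have C := sum_mean_close (k.+1 + k.+1) i; rewrite K3 in C.
  have D : (e1 i * e1 j +
      (if j != i then E (fun x => (X i x)%:R * (X j x)%:R) else 0)) *
     \sum_(1 <= u < m.+1 | close_to (k.+1 + k.+1) i u) e1 u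
     <= (e1 i * e1 j + c2) * ((K + 2) * ap).
    apply: ler_pM => //; last by rewrite lerD2l.
      rewrite addr_ge0 ?mulr_ge0//; case: ifP => // _.
      by apply: E0 => x; rewrite mulr_ge0.
    by apply: sumr_ge0.
  apply: (le_trans (lerD A D)).
  rewrite /c2 /c3; case: ifP => _; first (case: ifP => _);
    rewrite le_eqVlt; apply/orP; left; apply/eqP; ring.
have bound_i i : (1 <= i < m.+1)%N -> \sum_(1 <= j < m.+1 | close_to k.+1 i j)
    (e1 i * ((4 * K + 5) * ap ^+ 2) + e1 i * e1 j * ((K + 2) * ap)
       + (if j != i then if far_enough k1 k2 i j
            then (4 * K + 5) * ap ^+ 3 + (K + 2) * ap ^+ 3 else 0 else 0))
    <= e1 i * ((2 * K + 3) * (4 * K + 5) + (K + 3) * (K + 2) / 2) * ap ^+ 2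
       + 4 * ((5 * K + 7) * ap ^+ 3).
  move=> im; rewrite !big_split /= -big_mkcondr.
  have T1 := @sum_close k.+1 i (close_to k.+1 i) (e1 i * ((4 * K + 5) * ap ^+ 2))
    (mulr_ge0 (e10 i) (mulr_ge0 (addr_ge0 (mulr_ge0 (ler0n _ _) K0) (ler0n _ _)) a2))
    (fun _ => id).
  have T2 : \sum_(1 <= j < m.+1 | close_to k.+1 i j) e1 i * e1 j * ((K + 2) * ap) <=
      e1 i * ((k.+1%:R + 2) / 2 * ap) * ((K + 2) * ap).
    rewrite -mulr_suml -mulr_sumr; apply: ler_wpM2r.
      by rewrite mulr_ge0 ?addr_ge0.
    by apply: ler_wpM2l => //; exact: sum_mean_close.
  have T3 := @sum_close_far i ((4 * K + 5) * ap ^+ 3 + (K + 2) * ap ^+ 3)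
    (addr_ge0 (mulr_ge0 (addr_ge0 (mulr_ge0 (ler0n _ _) K0) (ler0n _ _)) a3)
      (mulr_ge0 (addr_ge0 K0 (ler0n _ _)) a3)).
  apply: (le_trans (lerD (lerD T1 T2) T3)).
  by rewrite -natr1 -/K le_eqVlt; apply/orP; left; apply/eqP; field.
apply: (@le_trans _ _ (\sum_(1 <= i < m.+1)
  (e1 i * ((2 * K + 3) * (4 * K + 5) + (K + 3) * (K + 2) / 2) * ap ^+ 2
       + 4 * ((5 * K + 7) * ap ^+ 3)))).
  apply: ler_sum_nat => i im; apply: le_trans (bound_i _ im).
  rewrite big_nat_cond [leRHS]big_nat_cond; apply: ler_sum => j /andP[jm cij].
  exact: bound_j.
rewrite big_split /= sum_cst -!mulr_suml.
have Q0 : 0 <= (2 * K + 3) * (4 * K + 5) + (K + 3) * (K + 2) / 2.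
  by rewrite addr_ge0 ?mulr_ge0 ?addr_ge0 ?invr_ge0// ?mulr_ge0.
apply: (le_trans (lerD (ler_wpM2r a2 (ler_wpM2r Q0 sum_mean_all)) (lexx _))).
by rewrite /iid_ld3_bound -/K le_eqVlt; apply/orP; left; apply/eqP; field.
Qed.

End iid_runs_bounds.

Section iid_side.
Variables (R : realType) (k1 k2 n : nat) (p : R).
Hypotheses (k1p : (1 <= k1)%N) (k2p : (1 <= k2)%N).
Hypothesis hn : (5 * (k1 + k2) <= n)%N.
Hypothesis p01 : 0 < p < 1.
Local Notation k := (k1 + k2)%N.
Local Notation m := (n - k)%N.
Local Notation ap := (arun k1 k2 p).
Local Notation X := (@runX k1 k2 n).
Local Notation psI := (fun _ : 'I_n => p).

Let p0 : 0 < p. Proof. by case/andP: p01. Qed.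
Let p1 : p < 1. Proof. by case/andP: p01. Qed.
Let K2 : 2 <= k%:R :> R. Proof. by rewrite (ler_nat R 2); lia. Qed.
Let KN : 5 * k%:R <= n%:R :> R. Proof. by rewrite -(natrM R 5) ler_nat. Qed.
Let kn : (k <= n)%N. Proof. lia. Qed.
Let ap0 : 0 <= ap.
Proof. by rewrite /arun mulr_ge0// exprn_ge0 ?subr_ge0 ?ltW. Qed.

Lemma ld2_iid_le : ld2 psI m k.+1 X <= (2 + (1 - p) * p) * h2 n k p * ap ^+ 2.
Proof.
apply: (le_trans (iid_ld2 p01 k1p k2p kn)).
by rewrite ler_wpM2r ?exprn_ge0// iid_ld2_bound_le.
Qed.

Lemma ld3_iid_le : ld3 psI m k.+1 X <= (2 + (1 - p) * p) * h1 n k p * ap ^+ 3.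
Proof.
apply: (le_trans (iid_ld3 p01 k1p k2p kn)).
by rewrite ler_wpM2r ?exprn_ge0// iid_ld3_bound_le.
Qed.

Lemma ldmean_iid_le : ldmean psI m X <= (2 + (1 - p) * p) * ap * (n%:R - k%:R).
Proof.
have -> : ldmean psI m X = \sum_(1 <= i < m.+1) pexp psI (fun x => (X i x)%:R).
  by rewrite -pexp_sum; apply: eq_pexp => x; rewrite natr_sum.
apply: (le_trans (sum_mean_all p01 k1p k2p kn)).
rewrite [leRHS]mulrAC ler_wpM2r//.
have : 0 <= (1 - p) * p by rewrite mulr_ge0 ?subr_ge0 ?ltW.
move: KN K2; set N := n%:R; set K := k%:R; set q := (1 - p) * p => h1 h2 h3.
have : 0 <= q * (N - K) by rewrite mulr_ge0//; lra.
lra.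
Qed.

(** [w2bar] is the bound on the coefficient [E S - (1 - w b) Var S]: its
  [|1 - w * b|] terms bound [E S - Var S], and its [|w * b|] term bounds
  [E S]. *)
Lemma w2bar_ge (w b : R) (v : R) :
  `|ldmean psI m X - v| <= ld2 psI m k.+1 X -> 0 <= ldmean psI m X ->
  `|ldmean psI m X - (1 - w * b) * v| <= w2bar k1 k2 n w b p.
Proof.
move=> hv m0; set mu := ldmean _ _ _ in hv m0 *.
rewrite (_ : mu - _ = (1 - w * b) * (mu - v) + w * b * mu); last by ring.
apply: (le_trans (ler_normD _ _)); rewrite (normrM (1 - w * b)) (normrM (w * b)) (ger0_norm m0).
apply: (@le_trans _ _ (`|1 - w * b| * ((2 + (1 - p) * p) * h2 n k p * ap ^+ 2)
  + `|w * b| * ((2 + (1 - p) * p) * ap * (n%:R - k%:R)))).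
  apply: lerD; apply: ler_wpM2l => //; last exact: ldmean_iid_le.
  exact: le_trans hv ld2_iid_le.
rewrite /w2bar /h2 le_eqVlt; apply/orP; left; apply/eqP; ring.
Qed.

End iid_side.

(** * From probability spaces to the product space *)

Section trials_to_product.
Context d (T : measurableType d) (R : realType) (P : probability T R).
Variables (n : nat) (eta : nat -> {RV P >-> bool}) (ps : nat -> R).
Hypothesis heta : bernoulli_trials P (fun i => eta i) n ps.

Local Notation Omega := {ffun 'I_n -> bool}.
Local Notation psI := (fun i : 'I_n => ps i.+1).

Definition outcome (t : T) : Omega := [ffun i : 'I_n => eta i.+1 t].

Let measurable_event (i : nat) (B : set bool) : measurable (eta i @^-1` B).
Proof. by rewrite -[_ @^-1` _]setTI; exact: measurable_funPT. Qed.

Lemma measurable_outcome (C : set Omega) : measurable (outcome @^-1` C).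
Proof.
have -> : outcome @^-1` C = \bigcup_(x in C) (\bigcap_(i in [set: 'I_n])
    (eta i.+1 @^-1` [set x i])).
  apply/seteqP; split => t /=.
    by move=> Ct; exists (outcome t) => // i _ /=; rewrite ffunE.
  case=> x Cx H; rewrite (_ : outcome t = x)//.
  by apply/ffunP => i; rewrite ffunE; exact: (H i).
apply: fin_bigcup_measurable => // x _.
by apply: fin_bigcap_measurable => // i _.
Qed.

Lemma trial_prob i b : (1 <= i <= n)%N ->
  P (eta i @^-1` [set b]) = (if b then ps i else 1 - ps i)%:E.
Proof.
move=> im; have Ht : P (eta i @^-1` [set true]) = (ps i)%:E by exact: heta.1.
case: b => //.
have -> : eta i @^-1` [set false] = ~` (eta i @^-1` [set true]).
  by apply/seteqP; split => t /=; case: (eta i t).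
by rewrite probability_setC// Ht.
Qed.

Lemma trial_prob01 (i : 'I_n) : 0 <= ps i.+1 <= 1.
Proof.
have := trial_prob true (ltn_ord i : 1 <= i.+1 <= n)%N.
rewrite -!lee_fin => <-; apply/andP; split; first exact: measure_ge0.
exact: probability_le1.
Qed.

Lemma outcome_prob (x : Omega) : P (outcome @^-1` [set x]) = (pweight psI x)%:E.
Proof.
have -> : outcome @^-1` [set x] =
    \bigcap_(i in [set i | i \in [set: 'I_n]%SET]) (eta i.+1 @^-1` [set x i]).
  apply/seteqP; split => t /=.
    by move=> <- i _ /=; rewrite ffunE.
  by move=> H; apply/ffunP => i; rewrite ffunE; apply: (H i); rewrite /= inE.
rewrite (heta.2 [set: 'I_n]%SET (fun i => [set x i])) //.
rewrite /pweight -prodEFin; apply: eq_big => [i|i _]; first by rewrite inE.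
by rewrite trial_prob ?ltn_ord.
Qed.

Let outcome_split (F : Omega -> R) t :
  F (outcome t) = \sum_x F x * \1_(outcome @^-1` [set x]) t.
Proof.
rewrite (bigD1 (outcome t))//= big1 => [|x xt].
  by rewrite addr0 indicE mem_set// mulr1.
by rewrite indicE memNset ?mulr0//= => /esym/eqP; apply/negP.
Qed.

(** A function of finitely many trials is a finite combination of indicators
  of the atoms, whose probabilities are the product weights. *)
Lemma expectation_outcome (F : Omega -> R) :
  ('E_P[fun t => F (outcome t)] = (pexp psI F)%:E)%E.
Proof.
rewrite unlock.
have mO x : measurable (outcome @^-1` [set x]) by exact: measurable_outcome.
transitivity (\int[P]_t (\sum_x (F x)%:E * (\1_(outcome @^-1` [set x]) t)%:E))%E.
  apply: eq_integral => t _; rewrite outcome_split -sumEFin.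
  by apply: eq_bigr => x _; rewrite EFinM.
rewrite integral_sum//; last first.
  by move=> x; apply: integrableZl => //; exact: integrable_indic.
rewrite /pexp -sumEFin; apply: eq_bigr => x _.
rewrite integralZl//; last exact: integrable_indic.
by rewrite integral_indic// setIT [X in (_ * X)%E](outcome_prob x) -EFinM mulrC.
Qed.

Lemma prob_outcome (C : set Omega) :
  P (outcome @^-1` C) = (pexp psI \1_C)%:E.
Proof.
by rewrite -expectation_outcome -expectation_indic//; exact: measurable_outcome.
Qed.

Lemma variance_outcome (F : Omega -> R) :
  ('V_P[fun t => F (outcome t)] =
   (pexp psI (fun x => (F x - pexp psI F) ^+ 2))%:E)%E.
Proof.
rewrite /variance unlock expectation_outcome /=.
by rewrite -expectation_outcome; congr expectation; apply: funext => t.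
Qed.

Variables k1 k2 : nat.

Lemma runI_outcome l t :
  runI k1 k2 n (fun i => eta i) l t = runI k1 k2 n (@trial_at n) l (outcome t).
Proof.
apply: runI_eq => c cn _ _; have cn' : (c.-1 < n)%N by lia.
rewrite (trial_atE _ cn') ffunE /=.
by case: c cn {cn'}.
Qed.

Definition runW (x : Omega) : nat :=
  (\sum_(1 <= l < (n - (k1 + k2)).+1) runX k1 k2 l x)%N.

Lemma runM_outcome t :
  runM k1 k2 n (fun i => eta i) t = runW (outcome t).
Proof. by apply: eq_bigr => l _; exact: runI_outcome. Qed.

End trials_to_product.

Lemma ler_sum_sub (R : realType) (T : eqType) (s1 s2 : seq T) (F : T -> R) :
  uniq s1 -> {subset s1 <= s2} -> (forall x, 0 <= F x) ->
  \sum_(x <- s1) F x <= \sum_(x <- s2) F x.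
Proof.
elim: s1 s2 => [|x s1 IH] s2 /=; first by move=> _ _ F0; rewrite big_nil sumr_ge0.
move=> /andP[xs1 us1] sub F0.
have xs2 : x \in s2 by apply: sub; rewrite mem_head.
rewrite big_cons (perm_big _ (perm_to_rem xs2)) big_cons lerD2l; apply: IH => // y ys1.
have : y \in s2 by apply: sub; rewrite in_cons ys1 orbT.
rewrite (perm_mem (perm_to_rem xs2)) in_cons => /orP[/eqP yx|//].
by rewrite yx (negbTE xs1) in ys1.
Qed.

(** The indices of the sums of the theorem run over integers, also outside
  [1, ..., n - k] where the indicators vanish. *)
Lemma ler_sum_int (R : realType) (m : nat) (P : pred nat) (s : seq int) (F : int -> R) :
  (forall j : nat, (1 <= j < m.+1)%N -> P j -> j%:Z \in s) -> (forall x, 0 <= F x) ->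
  \sum_(1 <= j < m.+1 | P j) F j%:Z <= \sum_(j <- s) F j.
Proof.
move=> sub F0; rewrite -big_filter.
rewrite -(big_map Posz predT F); apply: ler_sum_sub => //.
  by rewrite map_inj_uniq ?filter_uniq ?iota_uniq// => x y [].
move=> x /mapP[j]; rewrite mem_filter mem_index_iota => /andP[Pj jm] ->.
exact: sub.
Qed.

Lemma mem_zseq lo hi x : (x \in zseq lo hi) = (lo <= x <= hi).
Proof.
rewrite /zseq; case: ifP => lohi; last by rewrite in_nil; lia.
apply/mapP/idP => [[m]|xr]; first by rewrite mem_iota => ? ->; lia.
by exists (absz (x - lo)); [rewrite mem_iota|]; lia.
Qed.

Section runs_sums.
Context d (T : measurableType d) (R : realType) (P : probability T R).
Variables (n : nat) (eta : nat -> {RV P >-> bool}) (ps : nat -> R).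
Hypothesis heta : bernoulli_trials P (fun i => eta i) n ps.
Variables k1 k2 : nat.
Local Notation k := (k1 + k2)%N.
Local Notation m := (n - k)%N.
Local Notation psI := (fun i : 'I_n => ps i.+1).
Local Notation E := (pexp psI).
Local Notation X := (@runX k1 k2 n).
Local Notation XI l x := (runI k1 k2 n (@trial_at n) l x).
Local Notation I1 := (EI1 P k1 k2 n (fun i => eta i)).
Local Notation I2 := (EI2 P k1 k2 n (fun i => eta i)).
Local Notation I3 := (EI3 P k1 k2 n (fun i => eta i)).

Lemma EI1E l : I1 l = E (fun x => (XI l x)%:R).
Proof.
rewrite /EI1 (_ : (fun t => _) = (fun t => (XI l (outcome n eta t))%:R)).
  by rewrite (expectation_outcome heta (fun x => (XI l x)%:R)).
by apply: funext => t; rewrite runI_outcome.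
Qed.

Lemma EI2E l1 l2 : I2 l1 l2 = E (fun x => (XI l1 x)%:R * (XI l2 x)%:R).
Proof.
rewrite /EI2 (_ : (fun t => _) = (fun t =>
    (XI l1 (outcome n eta t))%:R * (XI l2 (outcome n eta t))%:R)).
  by rewrite (expectation_outcome heta (fun x => (XI l1 x)%:R * (XI l2 x)%:R)).
by apply: funext => t; rewrite !runI_outcome.
Qed.

Lemma EI3E l1 l2 l3 :
  I3 l1 l2 l3 = E (fun x => (XI l1 x)%:R * (XI l2 x)%:R * (XI l3 x)%:R).
Proof.
rewrite /EI3 (_ : (fun t => _) = (fun t => (XI l1 (outcome n eta t))%:R *
    (XI l2 (outcome n eta t))%:R * (XI l3 (outcome n eta t))%:R)).
  by rewrite (expectation_outcome heta
    (fun x => (XI l1 x)%:R * (XI l2 x)%:R * (XI l3 x)%:R)).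
by apply: funext => t; rewrite !runI_outcome.
Qed.

Let ps01 : forall i : 'I_n, 0 <= ps i.+1 <= 1.
Proof. exact: (trial_prob01 heta). Qed.

Lemma EI1_ge0 l : 0 <= I1 l.
Proof. by rewrite EI1E; apply: (pexp_ge0 ps01). Qed.

Lemma EI2_ge0 l1 l2 : 0 <= I2 l1 l2.
Proof. by rewrite EI2E; apply: (pexp_ge0 ps01) => // x; rewrite mulr_ge0. Qed.

Lemma EI3_ge0 l1 l2 l3 : 0 <= I3 l1 l2 l3.
Proof. by rewrite EI3E; apply: (pexp_ge0 ps01) => // x; rewrite !mulr_ge0. Qed.

Lemma ld2_runs_le : ld2 psI m k.+1 X <=
  \sum_(1 <= i0 < m.+1)
    (let i := i0%:Z in
     \sum_(j <- zseq (i - k%:Z - 1) (i + k%:Z + 1)) I2 i j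
     + I1 i * \sum_(j <- zseq (i - k%:Z - 1) (i + k%:Z + 1)) I1 j).
Proof.
apply: ler_sum_nat => i im /=.
have mem j : close_to k.+1 i j -> j%:Z \in zseq (i%:Z - k%:Z - 1) (i%:Z + k%:Z + 1).
  by rewrite mem_zseq /close_to; lia.
apply: lerD.
  under eq_bigr do rewrite -EI2E.
  apply: (@ler_sum_int _ m (fun j => close_to k.+1 i j && (j != i)) _ (I2 i)).
    by move=> j _ /andP[/mem].
  by move=> j; exact: EI2_ge0.
rewrite -EI1E; apply: ler_wpM2l; first exact: EI1_ge0.
under eq_bigr do rewrite -EI1E.
apply: (@ler_sum_int _ m (close_to k.+1 i) _ I1) => [j _ /mem//|j].
exact: EI1_ge0.
Qed.

Lemma ld3_runs_le : ld3 psI m k.+1 X <=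
  \sum_(1 <= i0 < m.+1)
    (let i := i0%:Z in
     \sum_(j <- zseq (i - k%:Z - 1) (i + k%:Z + 1))
       (\sum_(u <- zseq (i - 2 * k%:Z - 2) (j - 1) ++
                   zseq (i + k%:Z + 2) (i + 2 * k%:Z + 2))
          (I1 i * I2 j u + I3 i j u)
        + (I1 i * I1 j + I2 i j) *
          \sum_(u <- zseq (i - 2 * k%:Z - 2) (i + 2 * k%:Z + 2)) I1 u)).
Proof.
apply: ler_sum_nat => i im /=.
pose F (j : int) := \sum_(u <- zseq (i%:Z - 2 * k%:Z - 2) (j - 1) ++
      zseq (i%:Z + k%:Z + 2) (i%:Z + 2 * k%:Z + 2)) (I1 i * I2 j u + I3 i j u)
    + (I1 i * I1 j + I2 i j) *
      \sum_(u <- zseq (i%:Z - 2 * k%:Z - 2) (i%:Z + 2 * k%:Z + 2)) I1 u.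
have p1 := EI1_ge0; have p2 := EI2_ge0; have p3 := EI3_ge0.
apply: (@le_trans _ _ (\sum_(1 <= j < m.+1 | close_to k.+1 i j) F j%:Z)); last first.
  apply: (@ler_sum_int _ m (close_to k.+1 i) _ F) => [j _|j].
    by rewrite mem_zseq /close_to; lia.
  apply: addr_ge0; first by apply: sumr_ge0 => u _; rewrite addr_ge0 ?mulr_ge0.
  by rewrite mulr_ge0 ?addr_ge0 ?mulr_ge0//; apply: sumr_ge0.
rewrite big_nat_cond [leRHS]big_nat_cond; apply: ler_sum => j /andP[jm cij].
have if_le (c : bool) (z : R) : 0 <= z -> (if c then z else 0) <= z by case: c.
apply: lerD.
  apply: (@le_trans _ _ (\sum_(1 <= u < m.+1 | close_to (k.+1 + k.+1) i u &&
      ((u < j)%N || ~~ close_to k.+1 i u)) (I1 i * I2 j u + I3 i j u))).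
    apply: ler_sum => u _; rewrite -EI1E -EI2E -EI3E lerD2l; exact: if_le.
  apply: (@ler_sum_int _ m (fun u => close_to (k.+1 + k.+1) i u &&
      ((u < j)%N || ~~ close_to k.+1 i u)) _ (fun u => I1 i * I2 j u + I3 i j u)).
    by move=> u _; rewrite mem_cat !mem_zseq; move: cij; rewrite /close_to; lia.
  by move=> u; rewrite addr_ge0 ?mulr_ge0.
apply: ler_pM.
- by rewrite -!EI1E addr_ge0 ?mulr_ge0//; case: ifP => // _; rewrite -EI2E.
- by apply: sumr_ge0 => u _; rewrite -EI1E.
- by rewrite -!EI1E lerD2l -EI2E; exact: if_le.
under eq_bigr do rewrite -EI1E.
apply: (@ler_sum_int _ m (close_to (k.+1 + k.+1) i) _ I1) => // u _.
by rewrite mem_zseq /close_to; lia.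
Qed.

Lemma expectation_runM (F : nat -> R) :
  ('E_P[fun t => F (runM k1 k2 n (fun i => eta i) t)] =
   (E (fun x => F (runW k1 k2 x)))%:E)%E.
Proof.
rewrite -(expectation_outcome heta (fun x => F (runW k1 k2 x))).
by congr expectation; apply: funext => t; rewrite runM_outcome.
Qed.

Lemma mean_runM : ('E_P[fun t => (runM k1 k2 n (fun i => eta i) t)%:R] =
   (ldmean psI m X)%:E)%E.
Proof. exact: (expectation_runM (fun j => j%:R)). Qed.

Lemma variance_runM :
  ('V_P[fun t => (runM k1 k2 n (fun i => eta i) t)%:R] =
   (ldvar psI m X)%:E)%E.
Proof.
rewrite (_ : (fun t => _) = (fun t => (runW k1 k2 (outcome n eta t))%:R)).
  exact: (variance_outcome heta (fun x => (runW k1 k2 x)%:R)).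
by apply: funext => t; rewrite runM_outcome.
Qed.

Lemma prob_runM (B : set nat) :
  P (runM k1 k2 n (fun i => eta i) @^-1` B) =
  (E (fun x => \1_B (runW k1 k2 x)))%:E.
Proof.
have -> : runM k1 k2 n (fun i => eta i) @^-1` B =
    outcome n eta @^-1` (fun x => B (runW k1 k2 x)).
  by apply/seteqP; split => t /=; rewrite runM_outcome.
by rewrite (prob_outcome heta).
Qed.

Lemma prob_runM_int (A : set int) :
  P ((fun t => (runM k1 k2 n (fun i => eta i) t)%:Z) @^-1` A) =
  (E (fun x => \1_A (runW k1 k2 x)%:Z))%:E.
Proof. exact: (prob_runM (fun j => A j%:Z)). Qed.

Lemma measurable_runM (B : set nat) :
  measurable (runM k1 k2 n (fun i => eta i) @^-1` B).
Proof.
have -> : runM k1 k2 n (fun i => eta i) @^-1` B =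
    outcome n eta @^-1` (fun x => B (runW k1 k2 x)).
  by apply/seteqP; split => t /=; rewrite runM_outcome.
exact: measurable_outcome.
Qed.

Lemma runs_stein (g : nat -> R) (D c c0 : R) : (forall j, `|g j.+1 - g j| <= D) ->
  c0 = (1 - c) * ldmean psI m X ->
  `|E (fun x => (c0 + c * (runW k1 k2 x)%:R) * g (runW k1 k2 x).+1
                - (runW k1 k2 x)%:R * g (runW k1 k2 x))
    - (ldmean psI m X - (1 - c) * ldvar psI m X)
      * E (fun x => g (runW k1 k2 x).+2 - g (runW k1 k2 x).+1)|
  <= D * (2 * (`|1 - c| * ld3 psI m k.+1 X
               + `|c| * ld2 psI m k.+1 X)).
Proof.
move=> gD; apply: (ld_stein ps01 (fun i x => runI_le1 _ _ _ _ _ _) _ _ gD).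
- by move=> i; exact: runX_dep.
- by move=> i j; exact: runX_far.
Qed.

Lemma runs_ldvar_bound :
  `|ldmean psI m X - ldvar psI m X|
  <= ld2 psI m k.+1 X.
Proof.
apply: (@ldvar_bound R _ _ ps01 m k.+1 X (fun i => window n (i - 1) (i + k).+1)).
- by move=> i x; exact: runI_le1.
- by move=> i; exact: runX_dep.
- by move=> i j; exact: runX_far.
Qed.

End runs_sums.

(** * Discrete Gibbs measures and their Stein equation *)

Section bounded_functions.
Variables (R : realType).
Implicit Types (f g : int -> R).

Lemma indic01 (T : Type) (A : set T) (x : T) : 0 <= (\1_A x : R) <= 1.
Proof. by rewrite indicE; case: (_ \in _); rewrite /= ?lexx ler01. Qed.

Lemma bounded_funI g C : (forall x, `|g x| <= C) -> bounded_fun g.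
Proof.
move=> gC; exists C; split; first exact: num_real.
by move=> M CM x _; exact: le_trans (gC x) (ltW CM).
Qed.

Lemma bounded_fun_ex g : bounded_fun g -> exists C, forall x, `|g x| <= C.
Proof.
by move=> [M [_ H]]; exists (M + 1) => x; apply: (H (M + 1)) => //; rewrite ltrDl.
Qed.

Lemma supnorm_le f C : (forall x, `|f x| <= C) -> supnorm f <= C.
Proof.
move=> fC; apply: ge_sup; first by exists `|f 0|; exists 0.
by move=> _ [x _ <-].
Qed.

Lemma Dnorm_ge g j : bounded_fun g -> `|g (j%:Z + 1) - g j%:Z| <= Dnorm g.
Proof.
move=> /bounded_fun_ex[C gC]; apply: ub_le_sup; last by exists j.
exists (C + C) => _ [i _ <-]; apply: (le_trans (ler_normB _ _)).
exact: lerD.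
Qed.

Lemma Dnorm_ge0 g : bounded_fun g -> 0 <= Dnorm g.
Proof. by move=> /(Dnorm_ge 0); exact: le_trans. Qed.

End bounded_functions.

Section gibbs.
Context d (T : measurableType d) (R : realType) (P : probability T R).
Variables (Z : {RV P >-> nat}) (N : option nat) (w : R) (U : nat -> R).
Variables (beta a b : R).
Hypotheses (hZ : is_gibbs P Z N w U beta) (hU : gibbs_ratio N U a b).

Definition pmf (m : nat) : R := fine (P (Z @^-1` [set m])).

Let measurable_Z (B : set nat) : measurable (Z @^-1` B).
Proof. by rewrite -[_ @^-1` _]setTI; exact: measurable_funPT. Qed.

Lemma pmfE m : P (Z @^-1` [set m]) = (pmf m)%:E.
Proof. by rewrite /pmf fineK// fin_num_measure. Qed.

Lemma pmf_ge0 m : 0 <= pmf m.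
Proof. by rewrite fine_ge0. Qed.

Lemma expectation_series (h : nat -> R) : (forall m, 0 <= h m) ->
  (\sum_(0 <= m <oo) (h m * pmf m)%:E = 'E_P[fun t => h (Z t)])%E.
Proof.
move=> h0; rewrite expectation.unlock.
pose F (m : nat) : set T := Z @^-1` [set m].
have UT : \bigcup_m F m = [set: T].
  by apply/seteqP; split => // t _; exists (Z t).
transitivity (\int[P]_(t in \bigcup_m F m) (h (Z t))%:E)%E; first last.
  by rewrite UT.
rewrite ge0_integral_bigcup//=.
- apply: eq_eseriesr => m _.
  rewrite (eq_integral (fun=> (h m)%:E)) => [|t /[!inE] /= ->//].
  have mF : measurable (F m) by exact: measurable_Z.
  by rewrite integral_cst// EFinM -(pmfE m).
- by move=> m; exact: measurable_Z.
- rewrite UT; apply/measurable_realfun.measurable_EFinP => _ B mB.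
  by rewrite setTI; exact: (measurable_Z (h @^-1` B)).
- by move=> t _; rewrite lee_fin.
- by move=> i j _ _ [t [/= <- <-]].
Qed.

Lemma expectation_cvg (h : nat -> R) (c : R) : (forall m, 0 <= h m) ->
  ('E_P[fun t => h (Z t)] = c%:E)%E ->
  \sum_(0 <= m < K) h m * pmf m @[K --> \oo] --> c.
Proof.
move=> h0 Ec.
have H : (\sum_(0 <= m < K) h m * pmf m)%:E @[K --> \oo] --> c%:E.
  rewrite -Ec -expectation_series//.
  under eq_fun do rewrite -sumEFin.
  by apply: is_cvg_nneseries => m _ _; rewrite lee_fin mulr_ge0 ?pmf_ge0.
exact: (fine_cvg H).
Qed.

Lemma cvg_expectation (h : nat -> R) (c : R) : (forall m, 0 <= h m) ->
  \sum_(0 <= m < K) h m * pmf m @[K --> \oo] --> c ->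
  ('E_P[fun t => h (Z t)] = c%:E)%E.
Proof.
move=> h0 hc; rewrite -expectation_series//; apply/cvg_lim => //.
under eq_fun do rewrite sumEFin.
by apply: cvg_EFin => //; exact: nearW.
Qed.

Lemma gibbs_supp0 : gibbs_supp N 0.
Proof. by case: N. Qed.

Lemma gibbs_suppW m : gibbs_supp N m.+1 -> gibbs_supp N m.
Proof. by case: N => //= N0; exact: ltnW. Qed.

Let weight m : R := gibbs_exp N U m * w ^+ m / m`!%:R.

Let w0 : 0 < w. Proof. by case: hZ. Qed.

Let weight_ge0 m : 0 <= weight m.
Proof.
rewrite /weight /gibbs_exp; case: ifP => _; rewrite ?mul0r//.
by rewrite !mulr_ge0 ?expR_ge0 ?exprn_ge0 ?invr_ge0 ?ler0n// ltW.
Qed.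

Let weight_gt0 m : gibbs_supp N m -> 0 < weight m.
Proof.
rewrite /weight /gibbs_exp => ->.
by rewrite !mulr_gt0 ?expR_gt0 ?exprn_gt0 ?invr_gt0 ?ltr0n ?fact_gt0.
Qed.

Let beta_gt0 : 0 < beta.
Proof.
case: hZ => _ hb _; rewrite -lte_fin -hb.
apply: (@lt_le_trans _ _ (\sum_(0 <= m < 1) (weight m)%:E)%E).
  by rewrite big_nat1 lte_fin weight_gt0// gibbs_supp0.
by apply: nneseries_lim_ge => m _ _; rewrite lee_fin weight_ge0.
Qed.

Let pmf_weight m : pmf m = beta^-1 * weight m.
Proof. by case: hZ => _ _ hp; rewrite /pmf [P _]hp. Qed.

Lemma pmf_gt0 m : gibbs_supp N m -> 0 < pmf m.
Proof. by move=> /weight_gt0 ?; rewrite pmf_weight mulr_gt0 ?invr_gt0. Qed.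

Lemma pmf_eq0 m : ~~ gibbs_supp N m -> pmf m = 0.
Proof.
by move=> /negbTE sm; rewrite pmf_weight /weight /gibbs_exp sm !mul0r mulr0.
Qed.

(** Outside the support both sides vanish, and at the right end point
  [a + b * m] does; the identity thus holds for all [m]. *)
Lemma pmf_recursion m : m.+1%:R * pmf m.+1 = w * (a + b * m%:R) * pmf m.
Proof.
have [sm|sm] := boolP (gibbs_supp N m); last first.
  rewrite !pmf_eq0 ?mulr0//; by apply: contra sm; exact: gibbs_suppW.
rewrite !pmf_weight /weight -(hU sm) factS exprS natrM.
have e0 : gibbs_exp N U m != 0 by rewrite /gibbs_exp sm gt_eqF// expR_gt0.
have m0 : m.+1%:R != 0 :> R by rewrite pnatr_eq0.
have f0 : m`!%:R != 0 :> R by rewrite pnatr_eq0 -lt0n fact_gt0.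
by field; rewrite e0 nat1r m0 f0 gt_eqF.
Qed.

Lemma pmf_sum_cvg : \sum_(0 <= m < K) pmf m @[K --> \oo] --> (1 : R).
Proof.
rewrite (_ : (fun K => _) = (fun K => \sum_(0 <= m < K) 1 * pmf m)); last first.
  by apply: funext => K; apply: eq_bigr => m _; rewrite mul1r.
by apply: (@expectation_cvg (fun=> 1)) => //; exact: expectation_cst.
Qed.

Lemma pmf_sum_le1 K : \sum_(0 <= m < K) pmf m <= 1.
Proof.
rewrite -(cvg_lim _ pmf_sum_cvg)//; apply: nondecreasing_cvgn_le.
  by apply/nondecreasing_seqP => n; rewrite big_nat_recr//= lerDl pmf_ge0.
by apply/cvg_ex; exists 1; exact: pmf_sum_cvg.
Qed.

Variable mu : R.
Hypothesis mean : ('E_P[fun t => (Z t)%:R] = mu%:E)%E.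

Let mean_cvg : \sum_(0 <= m < K) m%:R * pmf m @[K --> \oo] --> mu.
Proof. exact: (@expectation_cvg (fun m => m%:R)). Qed.

Let mean_step K : \sum_(0 <= m < K.+1) m%:R * pmf m =
  w * a * (\sum_(0 <= m < K) pmf m) + w * b * \sum_(0 <= m < K) m%:R * pmf m.
Proof.
rewrite big_nat_recl//= mul0r add0r !mulr_sumr -big_split /=; apply: eq_bigr => m _.
by rewrite pmf_recursion; ring.
Qed.

(** Limit of [pmf_recursion] summed over [m < K]. *)
Lemma gibbs_mean : mu = w * a + w * b * mu.
Proof.
have H1 : \sum_(0 <= m < K.+1) m%:R * pmf m @[K --> \oo] --> mu.
  by have := mean_cvg; rewrite -cvg_shiftS.
have H2 : \sum_(0 <= m < K.+1) m%:R * pmf m @[K --> \oo] --> w * a * 1 + w * b * mu.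
  under eq_fun do rewrite mean_step.
  by apply: cvgD; apply: cvgMr => //; exact: pmf_sum_cvg.
by rewrite -[w * a]mulr1; exact: cvg_unique H1 H2.
Qed.

Lemma mu_ge0 : 0 <= mu.
Proof. by rewrite -lee_fin -mean; apply: expectation_ge0. Qed.

(** With infinite support all ratios [a + b * m] are positive, and
  [w * a = (1 - w * b) * mu] with [w * a > 0] forces [w * b < 1]. *)
Lemma gibbs_infinite : N = None -> [/\ 0 < a, 0 <= b & 0 < 1 - w * b].
Proof.
move=> Ninf; have pos m : 0 < a + b * m%:R.
  have supp k : gibbs_supp N k by rewrite Ninf.
  have := pmf_recursion m; have := pmf_gt0 (supp m); have := pmf_gt0 (supp m.+1).
  move=> p1 p2 e; have : 0 < w * (a + b * m%:R) * pmf m by rewrite -e mulr_gt0.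
  by rewrite pmulr_lgt0// pmulr_rgt0.
have a0 : 0 < a by have := pos 0%N; rewrite mulr0 addr0.
have b0 : 0 <= b.
  rewrite leNgt; apply/negP => bN.
  have := pos (Num.bound (a / - b)).
  have : a / - b < (Num.bound (a / - b))%:R.
    by apply: archi_boundP; rewrite divr_ge0 ?oppr_ge0 ?ltW.
  rewrite ltr_pdivrMr ?oppr_gt0//; lra.
split=> //; have := gibbs_mean; have := mu_ge0; have : 0 < w * a by rewrite mulr_gt0.
move=> wa m0 e; rewrite ltNge; apply/negP => h.
have : (1 - w * b) * mu <= 0 by rewrite mulr_le0_ge0.
lra.
Qed.

Let mean_le K : \sum_(0 <= m < K) m%:R * pmf m <= mu.
Proof.
rewrite -(cvg_lim _ mean_cvg)//; apply: nondecreasing_cvgn_le.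
  apply/nondecreasing_seqP => n; rewrite big_nat_recr//= lerDl.
  by rewrite mulr_ge0 ?pmf_ge0.
by apply/cvg_ex; exists mu; exact: mean_cvg.
Qed.

Let sq K := \sum_(0 <= m < K) m%:R ^+ 2 * pmf m.

Let sq_nd : nondecreasing_seq sq.
Proof.
apply/nondecreasing_seqP => n; rewrite /sq big_nat_recr//= lerDl.
by rewrite mulr_ge0 ?pmf_ge0// sqr_ge0.
Qed.

Let sq_step K : sq K.+1 = w * a * (\sum_(0 <= m < K) pmf m)
  + w * (a + b) * (\sum_(0 <= m < K) m%:R * pmf m) + w * b * sq K.
Proof.
rewrite /sq big_nat_recl//= expr2 !mul0r add0r !mulr_sumr -!big_split /=.
apply: eq_bigr => m _; rewrite expr2 -mulrA pmf_recursion -natr1; ring.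
Qed.

(** In the infinite case the recursion [sq K.+1 <= C + w * b * sq K] with
  [w * b < 1] bounds the truncated second moments. *)
Let sq_bounded : has_ubound (range sq).
Proof.
case Nv : N => [N0|].
  exists (N0%:R ^+ 2) => _ [K _ <-].
  apply: (@le_trans _ _ (\sum_(0 <= m < K) N0%:R ^+ 2 * pmf m)).
    apply: ler_sum => m _; have [sm|/pmf_eq0 ->] := boolP (gibbs_supp N m); last first.
      by rewrite !mulr0.
    by rewrite ler_wpM2r ?pmf_ge0// -!natrX ler_nat leq_exp2r//; move: sm; rewrite Nv.
  by rewrite -mulr_sumr ler_piMr ?sqr_ge0// pmf_sum_le1.
have [a0 b0 wb1] := gibbs_infinite Nv.
exists ((w * a + w * (a + b) * mu) / (1 - w * b)) => _ [K _ <-].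
rewrite ler_pdivlMr//.
have h1 : sq K <= sq K.+1 by apply: sq_nd.
have h2 := sq_step K.
have h3 : w * a * (\sum_(0 <= m < K) pmf m) <= w * a.
  by rewrite ler_piMr ?pmf_sum_le1// mulr_ge0// ltW.
have h4 : w * (a + b) * (\sum_(0 <= m < K) m%:R * pmf m) <= w * (a + b) * mu.
  by rewrite ler_wpM2l ?mean_le// mulr_ge0 ?addr_ge0// ltW.
lra.
Qed.

(** [pmf_recursion] multiplied by [m + 1] and summed gives a linear equation
  for the second moment. *)
Lemma gibbs_variance : (1 - w * b) * fine ('V_P[fun t => (Z t)%:R])%E = mu.
Proof.
have sq_cvg : sq @ \oo --> limn sq by exact: nondecreasing_is_cvgn.
set q := limn sq in sq_cvg.
have qE : q = w * a + w * (a + b) * mu + w * b * q.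
  have H1 : sq K.+1 @[K --> \oo] --> q by rewrite (cvg_shiftS sq).
  have H2 : sq K.+1 @[K --> \oo] --> w * a * 1 + w * (a + b) * mu + w * b * q.
    under eq_fun do rewrite sq_step.
    apply: cvgD; first by apply: cvgD; apply: cvgMr => //; exact: pmf_sum_cvg.
    exact: cvgMr.
  by rewrite -[w * a]mulr1; exact: cvg_unique H1 H2.
have VE : ('V_P[fun t => (Z t)%:R] = (q - mu ^+ 2)%:E)%E.
  rewrite /variance unlock mean /=.
  apply: (@cvg_expectation (fun m => (m%:R - mu) * (m%:R - mu))).
    by move=> m; exact: sqr_ge0.
  have H : sq K - 2 * mu * (\sum_(0 <= m < K) m%:R * pmf m)
      + mu ^+ 2 * (\sum_(0 <= m < K) pmf m) @[K --> \oo] -->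
      q - 2 * mu * mu + mu ^+ 2 * 1.
    apply: cvgD; last by apply: cvgMr; exact: pmf_sum_cvg.
    by apply: cvgB => //; exact: cvgMr.
  rewrite (_ : q - mu ^+ 2 = q - 2 * mu * mu + mu ^+ 2 * 1); last by ring.
  rewrite (_ : (fun K => _) = (fun K => sq K -
      2 * mu * (\sum_(0 <= m < K) m%:R * pmf m) + mu ^+ 2 * (\sum_(0 <= m < K) pmf m)))//.
  apply: funext => K; rewrite !mulr_sumr -sumrB -big_split.
  by apply: eq_bigr => m _ /=; ring.
rewrite VE /=; have e := gibbs_mean.
have wa : w * a = mu - w * b * mu by lra.
have : w * (a + b) * mu = (mu - w * b * mu) * mu + w * b * mu by rewrite -wa; ring.
rewrite expr2; lra.
Qed.

Section stein_equation.
Variable A : set int.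
Local Notation f m := ((\1_A (m%:Z)) : R).
Let e := fine ('E_P[fun t => f (Z t)])%E.

Let f01 m : 0 <= f m <= 1. Proof. exact: indic01. Qed.

Lemma expectation_indicator : ('E_P[fun t => f (Z t)] = (P (Z @^-1` (fun m => A m%:Z))))%E.
Proof. by rewrite -expectation_indic. Qed.

Let eE : ('E_P[fun t => f (Z t)] = e%:E)%E.
Proof. by rewrite /e fineK// expectation_indicator fin_num_measure. Qed.

Lemma expectation_indicator01 : 0 <= e <= 1.
Proof.
rewrite -!lee_fin -eE expectation_indicator measure_ge0 probability_le1//.
Qed.

(** These sums tend to zero, [f - e] having mean zero under [Z]. *)
Let psum K := \sum_(0 <= i < K) (f i - e) * pmf i.

Let psum_cvg : psum K @[K --> \oo] --> 0.
Proof.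
have H : \sum_(0 <= i < K) f i * pmf i - e * (\sum_(0 <= i < K) pmf i) @[K --> \oo]
    --> e - e * 1.
  apply: cvgB; last by apply: cvgMr; exact: pmf_sum_cvg.
  by apply: (@expectation_cvg (fun m => f m)) => // m; have /andP[] := f01 m.
rewrite -(_ : e - e * 1 = 0); last by rewrite mulr1 subrr.
rewrite (_ : psum = (fun K => \sum_(0 <= i < K) f i * pmf i -
    e * (\sum_(0 <= i < K) pmf i)))//.
apply: funext => K; rewrite mulr_sumr -sumrB; apply: eq_bigr => i _; ring.
Qed.

Let psum_end m : gibbs_supp N m -> ~~ gibbs_supp N m.+1 -> psum m.+1 = 0.
Proof.
move=> sm sm1.
have H : psum K @[K --> \oo] --> psum m.+1.
  apply: cvg_near_cst; exists m.+1 => // K /= mK.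
  rewrite /psum (big_cat_nat _ mK)//= [X in _ + X]big_nat_cond [X in _ + X]big1
    ?addr0// => i.
  move=> /andP[/andP[mi _] _]; rewrite pmf_eq0 ?mulr0//.
  by move: sm1; case: N => //= N0; lia.
exact: cvg_unique H psum_cvg.
Qed.

(** Multiplied by [pmf m], the Stein equation says that
  [m * pmf m * g m] has the increments [(f m - e) * pmf m]. *)
Definition stein_sol (x : int) : R :=
  if x is Posz m then if gibbs_supp N m then psum m / (m%:R * pmf m) else 0 else 0.

Let stein_solM m : gibbs_supp N m -> m%:R * pmf m * stein_sol m = psum m.
Proof.
move=> sm; rewrite /stein_sol sm; case: m sm => [|m] sm.
  by rewrite !mul0r /psum big_geq.
by rewrite mulrC divfK// mulf_neq0 ?pnatr_eq0// gt_eqF// pmf_gt0.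
Qed.

Lemma stein_sol_eq m : gibbs_supp N m ->
  stein_op w a b stein_sol m = f m - e.
Proof.
move=> sm; have p0 := pmf_gt0 sm.
apply: (mulfI (lt0r_neq0 p0)).
have -> : pmf m * stein_op w a b stein_sol m = psum m.+1 - psum m.
  rewrite -(stein_solM sm) /stein_op -PoszD addn1.
  have [sm1|sm1] := boolP (gibbs_supp N m.+1).
    by rewrite -(stein_solM sm1) pmf_recursion; ring.
  by rewrite (psum_end sm sm1) /= (negbTE sm1); ring.
by rewrite /psum big_nat_recr//=; ring.
Qed.

Let eventually_bounded m0 C : 0 <= C ->
  (forall m : nat, (m0 <= m)%N -> `|stein_sol m| <= C) -> bounded_fun stein_sol.
Proof.
move=> C0 H; apply: (@bounded_funI _ _ (C + \sum_(0 <= i < m0) `|stein_sol i|)).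
have S0 : 0 <= \sum_(0 <= i < m0) `|stein_sol i| by exact: sumr_ge0.
case=> [m|m]; last by rewrite normr0 addr_ge0.
have [mm0|mm0] := leqP m0 m; first by rewrite ler_wpDr// H.
rewrite ler_wpDl// (bigD1_seq m) ?iota_uniq ?mem_index_iota//= lerDl.
exact: sumr_ge0.
Qed.

(** Past [m0] the probability mass function decays geometrically, so the tail
  beyond [m] is of the order of [pmf m]; a partial sum of the centred [f] is
  minus its tail. *)
Let infinite_bounded : N = None -> bounded_fun stein_sol.
Proof.
move=> Ninf; have [a0 b0 wb1] := gibbs_infinite Ninf.
have supp m : gibbs_supp N m by rewrite Ninf.
pose rho := (1 + w * b) / 2.
have rho1 : 0 < 1 - rho by rewrite /rho; lra.
pose m0 := Num.bound (2 * (w * a) / (1 - w * b)).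
have m0P : 2 * (w * a) < m0%:R * (1 - w * b).
  rewrite -ltr_pdivrMr//; apply: archi_boundP.
  by rewrite divr_ge0 ?mulr_ge0 ?ltW.
have decay m : (m0 <= m)%N -> pmf m.+1 <= rho * pmf m.
  move=> m0m; have m1 : 0 < m.+1%:R :> R by rewrite ltr0n.
  rewrite -(ler_pM2l m1) pmf_recursion mulrA ler_wpM2r ?pmf_ge0//.
  have : m0%:R * (1 - w * b) <= m%:R * (1 - w * b) by rewrite ler_wpM2r ?ler_nat// ltW.
  have : 0 <= w * b by rewrite mulr_ge0// ltW.
  by rewrite -natr1 /rho; lra.
have tail m K : (m0 <= m)%N -> (m <= K)%N ->
    \sum_(m <= i < K) pmf i <= pmf m / (1 - rho).
  move=> m0m mK; rewrite ler_pdivlMr//.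
  have rho0 : 0 <= rho by rewrite /rho divr_ge0// addr_ge0// mulr_ge0// ltW.
  suff : \sum_(m <= i < K) pmf i <= pmf m + rho * \sum_(m <= i < K) pmf i by lra.
  case: K mK => [|K] mK.
    by rewrite big_geq// mulr0 addr0 pmf_ge0.
  case: (ltngtP m K.+1) mK => // [mK _|-> _]; last first.
    by rewrite big_geq// mulr0 addr0 pmf_ge0.
  rewrite {1}big_nat_recl// lerD2l [X in rho * X]big_nat_recr//= mulrDr.
  apply: ler_wpDr; first by rewrite mulr_ge0 ?pmf_ge0.
  rewrite mulr_sumr; apply: ler_sum_nat => i im.
  by apply: decay; lia.
have psum_tail m : (m0 <= m)%N -> `|psum m| <= pmf m / (1 - rho).
  move=> m0m; have H : `|psum K - psum m| @[K --> \oo] --> `|0 - psum m|.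
    by apply: cvg_norm; apply: cvgB => //; exact: cvg_cst.
  rewrite -normrN -sub0r; apply: (cvgr_to_le H); exists m => // K /= mK.
  rewrite /psum (big_cat_nat _ mK)//= addrAC subrr add0r.
  apply: (le_trans (ler_norm_sum _ _ _)); apply: le_trans (tail _ _ m0m mK).
  apply: ler_sum => i _; rewrite normrM (ger0_norm (pmf_ge0 i)) ler_piMl ?pmf_ge0//.
  have /andP[? ?] := f01 i; have /andP[? ?] := expectation_indicator01.
  by rewrite ler_norml; apply/andP; split; lra.
apply: (@eventually_bounded m0.+1 (1 - rho)^-1); first by rewrite invr_ge0 ltW.
move=> m m0m; have pm := pmf_gt0 (supp m); have m1 : 1 <= m%:R :> R by rewrite ler1n; lia.
have p1 : 0 < m%:R * pmf m by rewrite mulr_gt0// (lt_le_trans ltr01).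
rewrite -(ler_pM2l p1) -{1}(gtr0_norm p1) -normrM stein_solM//.
apply: (le_trans (psum_tail _ (ltnW m0m))).
by rewrite ler_wpM2r ?invr_ge0 ?(ltW rho1)// ler_peMl ?pmf_ge0.
Qed.

Lemma stein_sol_solution : stein_solution P Z N w a b \1_A stein_sol.
Proof.
split.
- case Nv : N => [N0|]; last exact: infinite_bounded.
  apply: (@eventually_bounded N0.+1 0) => // m mN.
  by rewrite /stein_sol Nv /= leqNgt mN normr0.
- by rewrite /stein_sol /=; case: ifP => // _; rewrite /psum big_geq// mul0r.
- by case=> // m nm; rewrite /stein_sol; case: ifP => // sm; case: nm; exists m.
- exact: stein_sol_eq.
Qed.

End stein_equation.

(** When [N] is finite, the Stein equation of the support says nothing beyond
  [N], and a function vanishing there does not control [P (S > N)].  Continuing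
  the solution with slope [- D] keeps its increments below [D], and the Stein
  operator then dominates every indicator beyond [N]: the slack comes from
  [(1 - pmf N) / N <= D], an increment of the solution for the set [{N}]. *)
Lemma stein_extension (A : set int) (D : R) :
  (forall B, Dnorm (stein_sol B) <= D) -> N <> Some 0%N ->
  exists g : nat -> R, (forall j, `|g j.+1 - g j| <= D) /\
    forall m, \1_A m%:Z - fine ('E_P[fun t => \1_A (Z t)%:Z])%E <=
      w * (a + b * m%:R) * g m.+1 - m%:R * g m.
Proof.
move=> DD N0; set e := fine _.
have [bg g0 gout geq] := stein_sol_solution A.
have inc j : `|stein_sol A j.+1%:Z - stein_sol A j%:Z| <= D.
  by have := Dnorm_ge j bg; rewrite -PoszD addn1 => /le_trans; apply.
case Nv : N => [n|].
  have n0 : (0 < n)%N by move: N0; rewrite Nv lt0n => h; apply/eqP => n0; apply: h; rewrite n0.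
  have sn : gibbs_supp N n by rewrite Nv /=.
  have pn1 : pmf n.+1 = 0 by apply: pmf_eq0; rewrite Nv /= ltnn.
  pose r := - (w * b).
  have abn : a + b * n%:R = 0.
    have := pmf_recursion n; rewrite pn1 mulr0 => /esym/eqP.
    by rewrite mulf_eq0 (gt_eqF (pmf_gt0 sn)) orbF mulf_eq0 (gt_eqF w0) => /eqP.
  have rE m : w * (a + b * m%:R) = r * (n%:R - m%:R).
    by rewrite /r -[a](addrK (b * n%:R)) abn; ring.
  have nR : 0 < n%:R :> R by rewrite ltr0n.
  have r0 : 0 < r.
    have s1 : gibbs_supp N 1 by rewrite Nv.
    have := pmf_recursion 0; rewrite rE mul1r subr0 => e1.
    have : 0 < r * n%:R * pmf 0 by rewrite -e1 pmf_gt0.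
    by rewrite pmulr_lgt0 ?pmf_gt0 ?gibbs_supp0// pmulr_lgt0.
  have D0 : 0 <= D by apply: le_trans (inc 0%N).
  set pn := pmf n.
  have pD : 1 - pn <= n%:R * D.
    have [bB _ outB eqB] := stein_sol_solution [set n%:Z].
    have := Dnorm_ge n bB; rewrite -PoszD addn1 (outB n.+1) => [H|[m]]; last first.
      by rewrite Nv /= => mn [nm]; move: mn; rewrite -nm ltnn.
    have /(_ n sn) := eqB.
    have -> : fine ('E_P[fun t => \1_[set n%:Z] (Z t)%:Z])%E = pn.
      rewrite expectation_indicator /pn /pmf; congr (fine (P _)).
      by apply/seteqP; split => x /= => [[]|->].
    rewrite /stein_op rE subrr mulr0 mul0r sub0r indicE mem_set//= => e1.
    rewrite -e1 -mulrN; apply: ler_wpM2l; first exact: ltW.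
    apply: le_trans (DD [set n%:Z]); apply: le_trans H.
    by rewrite sub0r ler_norm.
  have rp : n%:R * pn <= r * (1 - pn).
    have nE : n = n.-1.+1 by rewrite prednK.
    have := pmf_recursion n.-1; rewrite -nE rE.
    have -> : n%:R - n.-1%:R = 1 :> R by rewrite {1}nE -natr1 addrAC subrr add0r.
    rewrite mulr1 => ->; apply: ler_wpM2l; first exact: ltW.
    rewrite lerBrDr; apply: le_trans (pmf_sum_le1 n.+1).
    rewrite big_nat_recr//= lerD2r {2}nE big_nat_recr//= lerDr.
    by apply: sumr_ge0 => i _; exact: pmf_ge0.
  pose gn := stein_sol A n.
  have gnE : - (n%:R * gn) = \1_A n%:Z - e.
    by rewrite -(geq n sn) /stein_op rE subrr mulr0 mul0r sub0r.
  pose h m : R := if (m <= n)%N then stein_sol A m%:Z else gn - D * (m%:R - n%:R).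
  have hE m : (n <= m)%N -> h m = gn - D * (m%:R - n%:R).
    move=> nm; rewrite /h; case: leqP => [mn|//].
    have -> : m = n by lia.
    by rewrite subrr mulr0 subr0.
  (* h continues the solution with slope - D beyond n *)
  exists h; split => [j|m].
    have [jn|nj] := ltnP j n; first by rewrite /h jn ltnW// inc.
    rewrite !hE ?(leqW nj)// -natr1.
    by rewrite (_ : _ - _ = - D) ?normrN ?ger0_norm//; ring.
  have [mn|nm] := ltnP m n.
    rewrite /h mn ltnW// -(geq m) ?Nv /= ?(ltnW mn)//.
    by rewrite /stein_op -PoszD addn1.
  rewrite rE !hE ?(leqW nm)//.
  have [t ->] : exists t, m = (n + t)%N by exists (m - n)%N; lia.
  have -> : n%:R - (n + t)%:R = - t%:R :> R by rewrite natrD; ring.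
  have -> : (n + t).+1%:R - n%:R = t%:R + 1 :> R by rewrite -natr1 natrD; ring.
  have -> : (n + t)%:R - n%:R = t%:R :> R by rewrite natrD; ring.
  rewrite natrD; case: t => [|t].
    by rewrite oppr0 mulr0 mul0r addn0 sub0r addr0 mulr0 subr0 gnE.
  have t0 : 0 <= t%:R :> R by [].
  rewrite -natr1; set x := t%:R in t0 *.
  have fm1 : \1_A (n + t.+1)%N%:Z <= 1 :> R by rewrite indicE; case: (_ \in _).
  apply: (@le_trans _ _ (1 - e)); first by rewrite lerD2r.
  have e1 : e <= 1.
    rewrite /e expectation_indicator -lee_fin fineK ?fin_num_measure//.
    exact: probability_le1.
  have nN0 : n%:R != 0 :> R by rewrite gt_eqF.
  set nr := n%:R in nR pD rp gnE nN0 *.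
  have -> : r * - (x + 1) * (gn - D * (x + 1 + 1)) - (nr + (x + 1)) * (gn - D * (x + 1)) =
      r * (x + 1) * (- gn + D * (x + 1 + 1)) + (nr + (x + 1)) * (- gn + D * (x + 1)).
    by ring.
  have x1 : 1 <= x + 1 by rewrite lerDr.
  have Dx : D <= D * (x + 1) by rewrite ler_peMr.
  have [nA|nA] := boolP (n%:Z \in A); move: gnE; rewrite indicE ?nA ?(negbTE nA)/= => gnE.
    have u0 : 0 <= - gn.
      by rewrite -(pmulr_rge0 _ nR) mulrN gnE subr_ge0.
    have A1 : nr * (- gn) <= (nr + (x + 1)) * (- gn + D * (x + 1)).
      by apply: ler_pM; lra.
    have A2 : 0 <= r * (x + 1) * (- gn + D * (x + 1 + 1)).
      by rewrite !mulr_ge0 ?addr_ge0 ?mulr_ge0 ?addr_ge0// ltW.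
    by rewrite -gnE -mulrN; lra.
  have epn : e <= 1 - pn.
    rewrite /e expectation_indicator /pn /pmf -lee_fin fineK ?fin_num_measure//.
    rewrite EFinB fineK ?fin_num_measure// -probability_setC//.
    apply: le_measure; rewrite ?inE//; first exact: measurableC.
    by move=> z /= zA zn; move: nA; rewrite notin_setE -zn.
  have v0 : 0 <= - gn + D.
    by rewrite -(pmulr_rge0 _ nR) mulrDr mulrN gnE; lra.
  have A1 : (nr + 1) * (- gn + D) <= (nr + (x + 1)) * (- gn + D * (x + 1)).
    by apply: ler_pM; lra.
  have A2 : r * (- gn + D + D) <= r * (x + 1) * (- gn + D * (x + 1 + 1)).
    apply: ler_pM; [lra|lra|by rewrite ler_peMr// ltW|].
    by rewrite [D * (x + 1 + 1)]mulrDr mulr1; lra.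
  apply: le_trans (lerD A2 A1); rewrite -(ler_pM2l nR).
  have gE : nr * gn = e by lra.
  have -> : nr * (r * (- gn + D + D) + (nr + 1) * (- gn + D)) =
    r * (nr * D - nr * gn + nr * D) + (nr + 1) * (nr * D - nr * gn) by ring.
  rewrite gE.
  have B1 : r * (1 - pn) <= r * (nr * D - e + nr * D).
    by apply: ler_wpM2l; [exact: ltW|lra].
  have B2 : (nr + 1) * (1 - pn - e) <= (nr + 1) * (nr * D - e).
    by apply: ler_wpM2l; lra.
  apply: le_trans (lerD B1 B2); lra.
exists (fun m => stein_sol A m%:Z); split => // m.
by rewrite -(geq m) ?Nv// /stein_op -PoszD addn1.
Qed.

Lemma gibbs_mean0 : N = Some 0%N -> mu = 0.
Proof.
move=> N0; apply: cvg_unique mean_cvg _ => //.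
apply: cvg_near_cst; apply: nearW => K; apply: big1_seq => -[|m] _.
  by rewrite mul0r.
by rewrite pmf_eq0 ?mulr0// N0.
Qed.

(** The Stein equation only sees the test function through its deviation from
  its mean. *)
Lemma stein_solution_shift (A : set int) (c : R) (g : int -> R) :
  stein_solution P Z N w a b \1_A g ->
  stein_solution P Z N w a b (fun x => \1_A x - c) g.
Proof.
case=> bg g0 gout geq; split => // m sm; rewrite geq//.
have EB : ('E_P[fun t => (\1_A (Z t)%:Z - c)%R] = 'E_P[fun t => \1_A (Z t)%:Z] - c%:E)%E.
  rewrite unlock integralB_EFin//=.
  - have PT : P [set: T] = 1%E := probability_setT P.
    by rewrite integral_cst// -[in RHS](mulr1 c) EFinN EFinM -PT.
  - have -> : (fun t => \1_A (Z t)%:Z) = \1_(Z @^-1` (fun m => A m%:Z)) :> (T -> R).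
      by apply: funext => t; rewrite !indicE; congr (nat_of_bool _)%:R; apply/idP/idP;
         rewrite !inE.
    exact: integrable_indic.
  - exact: finite_measure_integrable_cst.
have fE : ('E_P[fun t => \1_A (Z t)%:Z])%E \is a fin_num.
  by rewrite expectation_indicator fin_num_measure.
by rewrite EB fineB//= opprB addrA subrK.
Qed.

End gibbs.

(** * Total variation and the comparison of the two laws *)

Section total_variation.
Context d1 d2 (T1 : measurableType d1) (T2 : measurableType d2) (R : realType).
Variables (P : probability T1 R) (X : T1 -> int) (Q : probability T2 R) (Y : T2 -> int).

Lemma dTV_le c :
  (forall A, `|fine (P (X @^-1` A)) - fine (Q (Y @^-1` A))| <= c) -> dTV P X Q Y <= c.
Proof.
move=> H; apply: ge_sup; first by eexists; exists setT.
by move=> _ [A _ <-].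
Qed.

Hypothesis mX : forall A, measurable (X @^-1` A).
Hypothesis mY : forall A, measurable (Y @^-1` A).

Lemma dTV_ge A : `|fine (P (X @^-1` A)) - fine (Q (Y @^-1` A))| <= dTV P X Q Y.
Proof.
apply: ub_le_sup; last by exists A.
have b01 d (T : measurableType d) (P0 : probability T R) (B : set T) :
    measurable B -> 0 <= fine (P0 B) <= 1.
  by move=> mB; rewrite -!lee_fin fineK ?fin_num_measure// measure_ge0 probability_le1.
exists 1 => _ [B _ <-]; have /andP[? ?] := b01 _ _ P _ (mX B).
have /andP[? ?] := b01 _ _ Q _ (mY B).
by rewrite ler_norml; apply/andP; split; lra.
Qed.

End total_variation.

(** Split the values of [W] by the sign of the difference of the two mass
  functions: on each part this difference sums up to a difference of the
  probabilities of one event. *)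
Lemma pexp_dist (R : realType) (I : finType) (ps ps' : I -> R)
    (W : {ffun I -> bool} -> nat) (h : nat -> R) (D d : R) :
  (forall j, `|h j| <= D) ->
  (forall A : set int,
     `|pexp ps (fun x => \1_A (W x)%:Z) - pexp ps' (fun x => \1_A (W x)%:Z)| <= d) ->
  `|pexp ps (fun x => h (W x)) - pexp ps' (fun x => h (W x))| <= 2 * D * d.
Proof.
move=> hD hA.
have D0 : 0 <= D by apply: le_trans (hD 0%N).
have [K WK] : exists K, forall x, (W x < K)%N.
  exists (\max_x W x).+1 => x; rewrite ltnS; exact: leq_bigmax.
pose mass q j : R := pexp q (fun x => (W x == j)%:R).
have byvalue q (f : nat -> R) :
    pexp q (fun x => f (W x)) = \sum_(0 <= j < K) f j * mass q j.
  under [RHS]eq_bigr do rewrite -pexpZ.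
  rewrite -pexp_sum; apply: eq_pexp => x.
  rewrite (bigD1_seq (W x)) ?iota_uniq ?mem_index_iota ?WK//= eqxx mulr1.
  by rewrite big1 ?addr0// => j; rewrite eq_sym => /negbTE ->; rewrite mulr0.
rewrite !byvalue -sumrB.
pose dm j := mass ps j - mass ps' j.
apply: (@le_trans _ _ (D * \sum_(0 <= j < K) `|dm j|)).
  rewrite mulr_sumr; apply: (le_trans (ler_norm_sum _ _ _)); apply: ler_sum => j _.
  by rewrite -mulrBr normrM ler_wpM2r.
rewrite [2 * D]mulrC -mulrA ler_wpM2l//.
pose A := [set x : int | if x is Posz j then 0 <= dm j else false].
have indA (B : set int) :
   pexp ps (fun x => \1_B (W x)%:Z) - pexp ps' (fun x => \1_B (W x)%:Z) =
   \sum_(0 <= j < K) \1_B j%:Z * dm j.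
  rewrite (byvalue _ (fun j => \1_B j%:Z)) (byvalue _ (fun j => \1_B j%:Z)) -sumrB.
  by apply: eq_bigr => j _; rewrite -mulrBr.
have -> : \sum_(0 <= j < K) `|dm j| =
    \sum_(0 <= j < K) \1_A j%:Z * dm j - \sum_(0 <= j < K) \1_(~` A) j%:Z * dm j.
  rewrite -sumrB; apply: eq_bigr => j _; rewrite !indicE in_setC.
  have [dj|dj] := leP 0 (dm j).
    by rewrite mem_set//= mul1r mul0r subr0 ger0_norm.
  rewrite memNset /=; last by apply/negP; rewrite -ltNge.
  by rewrite mul0r mul1r sub0r ltr0_norm.
have := hA A; have := hA (~` A); rewrite !indA => /ler_normlP[h1 _] /ler_normlP[_ h2].
rewrite mulr_natl mulr2n; lra.
Qed.

Section stein_transfer.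
Context dM (TM : measurableType dM) (R : realType) (PM : probability TM R).
Variables (n : nat) (eta : nat -> {RV PM >-> bool}) (ps : nat -> R).
Hypothesis heta : bernoulli_trials PM (fun i => eta i) n ps.
Variables k1 k2 : nat.
Context dZ (TZ : measurableType dZ) (PZ : probability TZ R).
Variables (Z : {RV PZ >-> nat}) (N : option nat) (w : R) (U : nat -> R).
Variables (beta a b mu : R).
Hypotheses (hZ : is_gibbs PZ Z N w U beta) (hU : gibbs_ratio N U a b).
Hypothesis mean : ('E_PZ[fun t => (Z t)%:R] = mu%:E)%E.
Local Notation k := (k1 + k2)%N.
Local Notation m := (n - k)%N.
Local Notation psI := (fun i : 'I_n => ps i.+1).
Local Notation E := (pexp psI).
Local Notation X := (@runX k1 k2 n).
Local Notation W x := (runW k1 k2 x).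
Hypothesis meanW : ldmean psI m X = mu.

Let ps01 : forall i : 'I_n, 0 <= ps i.+1 <= 1.
Proof. exact: (trial_prob01 heta). Qed.

Let c0E : w * a = (1 - w * b) * ldmean psI m X.
Proof. rewrite meanW; have e := gibbs_mean hZ hU mean; lra. Qed.

Definition run_stein_err : R :=
  2 * (`|1 - w * b| * ld3 psI m k.+1 X + `|w * b| * ld2 psI m k.+1 X).

Definition run_stein_coef : R := mu - (1 - w * b) * ldvar psI m X.

Lemma gibbs_op_runs (g : nat -> R) (D : R) : (forall j, `|g j.+1 - g j| <= D) ->
  `|E (fun x => w * (a + b * (W x)%:R) * g (W x).+1 - (W x)%:R * g (W x))
    - run_stein_coef * E (fun x => g (W x).+2 - g (W x).+1)| <= D * run_stein_err.
Proof.
move=> gD; have := @runs_stein _ _ _ PM n eta ps heta k1 k2 g D _ _ gD c0E; rewrite meanW.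
congr (`|_ - _| <= _); apply: eq_pexp => x; ring.
Qed.

(** Outside the support the solution and its Stein operator vanish, and the
  deviation of the indicator from its mean is at most 1. *)
Lemma stein_transfer (A : set int) (g : int -> R) (D : R) :
  stein_solution PZ Z N w a b \1_A g -> Dnorm g <= D ->
  `|E (fun x => \1_A (W x)%:Z) - fine ('E_PZ[fun t => \1_A (Z t)%:Z])%E
    - run_stein_coef * E (fun x => g (W x).+2%:Z - g (W x).+1%:Z)|
  <= D * run_stein_err
     + fine (PM [set t | ~~ gibbs_supp N (runM k1 k2 n (fun i => eta i) t)]).
Proof.
case=> bg g0 gout geq gD; set e := fine ('E__[_]).
have inc j : `|g j.+1%:Z - g j%:Z| <= D.
  by apply: le_trans gD; have := Dnorm_ge j bg; rewrite -PoszD addn1.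
pose out (j : nat) : R := if gibbs_supp N j then 0 else \1_A j%:Z - e.
have opE (j : nat) : \1_A j%:Z - e =
    (w * (a + b * j%:R) * g j.+1%:Z - j%:R * g j%:Z) + out j.
  rewrite /out; case: ifPn => sj.
    by rewrite addr0 -geq// /stein_op -PoszD addn1.
  rewrite (gout j) => [|[i si [ij]]]; last by move: sj; rewrite ij si.
  rewrite (gout j.+1) => [|[i si [ij]]].
    by rewrite !mulr0 subr0 add0r.
  by move: sj; rewrite (@gibbs_suppW N j)// ij.
have -> : E (fun x => \1_A (W x)%:Z) - e =
    E (fun x => w * (a + b * (W x)%:R) * g (W x).+1%:Z - (W x)%:R * g (W x)%:Z)
    + E (fun x => out (W x)).
  rewrite -{1}(pexp_cst psI e) -pexpB -pexpD; apply: eq_pexp => x; exact: opE.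
rewrite addrAC; apply: (le_trans (ler_normD _ _)); apply: lerD.
  exact: (gibbs_op_runs (g := fun j => g j%:Z) inc).
apply: (le_trans (ler_norm_pexp ps01 _)).
rewrite [X in _ <= fine X](prob_runM heta k1 k2 (fun j => ~~ gibbs_supp N j)) /=.
apply: le_pexp => // x; rewrite /out.
have [sx|sx] := boolP (gibbs_supp N (W x)); first by rewrite normr0.
have -> : \1_(fun j => ~~ gibbs_supp N j) (W x) = 1 :> R by rewrite indicE mem_set.
have e01 : 0 <= e <= 1.
  exact: expectation_indicator01.
case/andP: e01 => h1 h2; have /andP[h3 h4] := indic01 R A (W x)%:Z.
by rewrite ler_norml; apply/andP; split; lra.
Qed.

End stein_transfer.

Theorem theorem3p2 (R : realType)
  (k1 k2 n : nat) (hk1 : (1 <= k1)%N) (hk2 : (1 <= k2)%N)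
  (hn : (5 * (k1 + k2) <= n)%N)
  (* the independent trials behind M *)
  (dM : measure_display) (TM : measurableType dM) (PM : probability TM R)
  (eta : nat -> {RV PM >-> bool}) (ps : nat -> R)
  (heta : bernoulli_trials PM (fun i => eta i) n ps)
  (* the i.i.d. trials behind S *)
  (dS : measure_display) (TS : measurableType dS) (PS : probability TS R)
  (xi : nat -> {RV PS >-> bool}) (p : R) (hp : 0 < p < 1)
  (hxi : bernoulli_trials PS (fun i => xi i) n (fun=> p))
  (* the discrete Gibbs measure *)
  (dZ : measure_display) (TZ : measurableType dZ) (PZ : probability TZ R)
  (Z : {RV PZ >-> nat}) (N : option nat) (w : R) (U : nat -> R) (beta a b : R)
  (hZ : is_gibbs PZ Z N w U beta) (hU : gibbs_ratio N U a b)
  (w1 gamma : R) (hw1 : 0 < w1) (hgamma : 0 < gamma)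
  (hstein : forall f g0 : int -> R, bounded_fun f ->
     stein_solution PZ Z N w a b f g0 ->
     Dnorm g0 <= w1 * supnorm f * Num.min 1 gamma^-1) :
  let M : TM -> nat := runM k1 k2 n (fun i => eta i) in
  let S : TS -> nat := runM k1 k2 n (fun i => xi i) in
  let w2 := w2bar k1 k2 n w b p in
  let VarM := fine 'V_PM[fun t => (M t)%:R] in
  let VarS := fine 'V_PS[fun t => (S t)%:R] in
  let VarZ := fine 'V_PZ[fun t => (Z t)%:R] in
  let tau := VarM - VarS in
  let phi := VarZ - VarS in
  let k := (k1 + k2)%N in
  let ap := arun k1 k2 p in
  let dZM := dTV PZ (fun t => (Z t)%:Z) PM (fun t => (M t)%:Z) in
  let dZS := dTV PZ (fun t => (Z t)%:Z) PS (fun t => (S t)%:Z) in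
  w1 * w2 < gamma ->
  ('E_PS[fun t => (S t)%:R] = 'E_PM[fun t => (M t)%:R])%E ->
  ('E_PZ[fun t => (Z t)%:R] = 'E_PS[fun t => (S t)%:R])%E ->
  dZM <= gamma / (2 * (gamma - w1 * w2)) *
         (w1 * epsbar PM k1 k2 n (fun i => eta i) w b p tau *
            Num.min 1 gamma^-1
          + 2 * fine (PS [set t | ~~ gibbs_supp N (S t)])
          + 2 * fine (PM [set t | ~~ gibbs_supp N (M t)]))
         + dZS
  /\
  dZS <= stein_Dnorm PZ Z N w a b *
         (2 * (2 + (1 - p) * p) * ap ^+ 2 *
            (`|1 - w * b| * h1 n k p * ap + `|w * b| * h2 n k p)
          + `|phi * (1 - w * b)|).
Proof.
move=> M S w2 VarM VarS VarZ tau phi k ap dZM dZS hw2 ESM EZS.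
pose psS := fun _ : 'I_n => p; pose psM := fun i : 'I_n => ps i.+1.
pose X := @runX k1 k2 n.
pose mu := ldmean psS (n - k) X.
have meanS := mean_runM hxi k1 k2; have meanM := mean_runM heta k1 k2.
have meanZ : ('E_PZ[fun t => (Z t)%:R] = mu%:E)%E by rewrite EZS.
have mM : ldmean psM (n - k) X = mu.
  by apply: EFin_inj; rewrite -[LHS]meanM -[RHS]meanS.
have mu0 : 0 <= mu by rewrite -lee_fin -meanZ; apply: expectation_ge0.
have VSE : VarS = ldvar psS (n - k) X by rewrite /VarS (variance_runM hxi).
have VME : VarM = ldvar psM (n - k) X by rewrite /VarM (variance_runM heta).
have VZE : (1 - w * b) * VarZ = mu := gibbs_variance hZ hU meanZ.
have sol := stein_sol_solution hZ hU meanZ.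
have wbE : w * a = (1 - w * b) * mu by have e := gibbs_mean hZ hU meanZ; lra.
pose errS := run_stein_err n (fun=> p) k1 k2 w b.
pose errM := run_stein_err n ps k1 k2 w b.
pose cS := run_stein_coef n (fun=> p) k1 k2 w b mu.
pose cM := run_stein_coef n ps k1 k2 w b mu.
have cSE : cS = phi * (1 - w * b).
  by rewrite /cS /run_stein_coef -/psS -/X -VSE -{1}VZE /phi; ring.
have cMS : cM - cS = - ((1 - w * b) * tau).
  by rewrite /cM /cS /run_stein_coef -/psS -/psM -/X -VSE -VME /tau; ring.
(* the expansion of the zero function reads 0 <= errS *)
have errS0 : 0 <= errS.
  have := gibbs_op_runs hxi hZ hU meanZ erefl (g := fun=> 0) (D := 1).
  rewrite mul1r => H; apply: le_trans (normr_ge0 _) (H _) => j.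
  by rewrite subrr normr0 ler01.
pose eA A := fine ('E_PZ[fun t => \1_A (Z t)%:Z])%E.
have eAE A : fine (PZ ((fun t => (Z t)%:Z) @^-1` A)) = eA A.
  by rewrite /eA expectation_indicator.
pose sA A := pexp psS (fun x => \1_A (runW k1 k2 x)%:Z).
pose mA A := pexp psM (fun x => \1_A (runW k1 k2 x)%:Z).
have sAE A : fine (PS ((fun t => (S t)%:Z) @^-1` A)) = sA A.
  by rewrite [PS _](prob_runM_int hxi).
have mAE A : fine (PM ((fun t => (M t)%:Z) @^-1` A)) = mA A.
  by rewrite [PM _](prob_runM_int heta).
have mZ A : measurable ((fun t => (Z t)%:Z) @^-1` A).
  have mZ (B : set nat) : measurable (Z @^-1` B).
    by rewrite -[_ @^-1` _]setTI; exact: measurable_funPT.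
  exact: (mZ (fun j => A j%:Z)).
have mS A : measurable ((fun t => (S t)%:Z) @^-1` A).
  exact: (@measurable_runM _ _ _ PS n xi k1 k2 (fun j => A j%:Z)).
have mMm A : measurable ((fun t => (M t)%:Z) @^-1` A).
  exact: (@measurable_runM _ _ _ PM n eta k1 k2 (fun j => A j%:Z)).
have probC dd (TT : measurableType dd) (PP : probability TT R) (B : set TT) :
    measurable B -> fine (PP (~` B)) = 1 - fine (PP B).
  by move=> mB; rewrite probability_setC// fineB// fin_num_measure.
have eAC A : eA (~` A) = 1 - eA A.
  by rewrite -(eAE (~` A)) -(eAE A) preimage_setC; exact: probC (mZ A).
have sAC A : sA (~` A) = 1 - sA A.
  by rewrite -(sAE (~` A)) -(sAE A) preimage_setC; exact: probC (mS A).
have ap0 : 0 <= ap.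
  by case/andP: hp => p0 p1; rewrite /ap /arun mulr_ge0// exprn_ge0 ?subr_ge0 ?ltW.
have errSle : errS <= 2 * (2 + (1 - p) * p) * ap ^+ 2 *
    (`|1 - w * b| * h1 n k p * ap + `|w * b| * h2 n k p).
  have l3 := ld3_iid_le hk1 hk2 hn hp; have l2 := ld2_iid_le hk1 hk2 hn hp.
  rewrite /errS /run_stein_err.
  apply: (@le_trans _ _ (2 * (`|1 - w * b| * ((2 + (1 - p) * p) * h1 n k p * ap ^+ 3)
    + `|w * b| * ((2 + (1 - p) * p) * h2 n k p * ap ^+ 2)))).
    by rewrite ler_wpM2l// lerD// ler_wpM2l.
  by rewrite le_eqVlt; apply/orP; left; apply/eqP; ring.
split; last first.
  set D := stein_Dnorm PZ Z N w a b.
  have DD B : Dnorm (stein_sol Z N B) <= D.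
    apply: ub_le_sup; last by exists B, (stein_sol Z N B).
    exists (w1 * 1 * Num.min 1 gamma^-1) => _ [A [g [gsol ->]]].
    have A1 x : `|\1_A x : R| <= 1.
      by have /andP[h1 h2] := indic01 R A x; rewrite ger0_norm.
    apply: (le_trans (hstein _ _ (bounded_funI A1) gsol)).
    rewrite ler_wpM2r ?le_min ?ler01 ?invr_ge0 ?(ltW hgamma)//.
    by rewrite ler_wpM2l ?(ltW hw1)// supnorm_le.
  have D0 : 0 <= D.
    by apply: le_trans (DD set0); apply: Dnorm_ge0; case: (sol set0).
  (* the upper bound for all A, applied to complements, gives both signs *)
  have key A : sA A - eA A <= D * (errS + `|phi * (1 - w * b)|).
    have [N0|N0] := pselect (N = Some 0%N).
      (* Z is almost surely zero, and so is S, which has the same mean *)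
      have eA0 : eA A = \1_A 0.
        have [_ _ gout geq] := sol A; have := geq 0%N (gibbs_supp0 N).
        rewrite /stein_op mul0r subr0 gout ?mulr0 => [/eqP|[j]].
          by rewrite eq_sym subr_eq0 => /eqP.
        by rewrite N0 /= leqn0 => /eqP ->.
      apply: (@le_trans _ _ 0); last by rewrite mulr_ge0 ?addr_ge0.
      rewrite eA0 -(gibbs_mean0 hZ meanZ N0) -(pexp_cst psS (\1_A 0)) -pexpB.
      apply: le_pexp => [i|x]; first exact: (trial_prob01 hxi i).
      rewrite -[X in _ <= X%:R]/(runW k1 k2 x).
      have /andP[h1 h2] := indic01 R A (runW k1 k2 x)%:Z.
      have /andP[h3 h4] := indic01 R A 0.
      case: (runW k1 k2 x) h1 h2 => [|j] h1 h2; first by rewrite subrr.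
      have : 1 <= j.+1%:R :> R by rewrite ler1n.
      lra.
    have [gh [ghD ghE]] := stein_extension hZ hU meanZ A DD N0.
    have := gibbs_op_runs hxi hZ hU meanZ erefl ghD.
    rewrite -/errS -/cS; set Eop := pexp _ _; set Edg := pexp _ _ => /ler_normlP[_ h].
    have sop : sA A - eA A <= Eop.
      rewrite -(pexp_cst psS (eA A)) -pexpB.
      apply: le_pexp => [i|x]; first exact: (trial_prob01 hxi i).
      exact: ghE.
    have Edg_le : cS * Edg <= `|phi * (1 - w * b)| * D.
      apply: (le_trans (ler_norm _)); rewrite normrM cSE ler_wpM2l//.
      apply: (le_trans (ler_norm_pexp (trial_prob01 hxi) _)).
      rewrite -[leRHS](pexp_cst psS); apply: le_pexp => [i|x]; last exact: ghD.
      exact: (trial_prob01 hxi i).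
    by rewrite mulrDr [D * `|_|]mulrC; lra.
  apply: (@le_trans _ _ (D * (errS + `|phi * (1 - w * b)|))); last first.
    by rewrite ler_wpM2l// lerD2r.
  apply: dTV_le => A; rewrite eAE sAE ler_norml; apply/andP; split; last first.
    have := key (~` A); rewrite eAC sAC => h; apply: le_trans h; lra.
  by rewrite lerNl opprB.
set d := dTV PS (fun t => (S t)%:Z) PM (fun t => (M t)%:Z).
have dP A : `|sA A - mA A| <= d by rewrite -(sAE A) -(mAE A); exact: dTV_ge.
have d0 : 0 <= d by apply: le_trans (dP set0).
have tri : dZM <= d + dZS.
  apply: dTV_le => A; rewrite -(subrKA (fine (PS ((fun t => (S t)%:Z) @^-1` A)))).
  rewrite addrC; apply: (le_trans (ler_normD _ _)); apply: lerD; first exact: dTV_ge.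
  exact: dTV_ge.
apply: (le_trans tri); rewrite lerD2r.
set mn := Num.min 1 gamma^-1.
have mn0 : 0 <= mn by rewrite le_min ler01 invr_ge0 ltW.
have mng : mn <= gamma^-1 by rewrite ge_min lexx orbT.
set outS := fine (PS _); set outM := fine (PM _).
set eps := epsbar _ _ _ _ _ _ _ _ _.
pose D := w1 * (1 / 2) * mn.
have D0 : 0 <= D by rewrite /D !mulr_ge0// ltW.
have DD A : Dnorm (stein_sol Z N A) <= D.
  have A1 x : `|\1_A x - 1 / 2 : R| <= 1 / 2.
    have /andP[h1 h2] := indic01 R A x.
    by rewrite ler_norml; apply/andP; split; lra.
  apply: (le_trans (hstein _ _ (bounded_funI A1) (stein_solution_shift (1 / 2) (sol A)))).
  by rewrite /D ler_wpM2r// ler_wpM2l ?(ltW hw1)// supnorm_le.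
have errE : errS + errM + `|(1 - w * b) * tau| <= eps.
  have l3 := ld3_runs_le heta k1 k2; have l2 := ld2_runs_le heta k1 k2.
  rewrite normrM /eps /epsbar; set L3 := \sum_(_ <= _ < _) _ in l3 *.
  set L2 := \sum_(_ <= _ < _) _ in l2 *.
  have errMle : errM <= 2 * (`|1 - w * b| * L3 + `|w * b| * L2).
    by rewrite ler_wpM2l// lerD// ler_wpM2l.
  apply: (le_trans (lerD (lerD errSle errMle) (lexx _))).
  by rewrite -/ap le_eqVlt; apply/orP; left; apply/eqP; rewrite /k; field.
have cSw2 : `|cS| <= w2.
  apply: (w2bar_ge hk1 hk2 hn hp) => //.
  exact: (runs_ldvar_bound hxi k1 k2).
have main A : `|sA A - mA A| <= D * (eps + 2 * (w2 * d)) + outS + outM.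
  have inc j : `|stein_sol Z N A j.+2%:Z - stein_sol Z N A j.+1%:Z| <= D.
    have [bg _ _ _] := sol A; apply: le_trans (DD A).
    by have := Dnorm_ge j.+1 bg; rewrite -PoszD addn1.
  have := stein_transfer hxi hZ hU meanZ erefl (sol A) (DD A).
  have := stein_transfer heta hZ hU meanZ mM (sol A) (DD A).
  rewrite -/(sA A) -/(mA A) -/(eA A) -/errS -/errM -/cS -/cM.
  set dgM := pexp psM _; set dgS := pexp psS _ => hM hS.
  have dgM_le : `|dgM| <= D.
    apply: (le_trans (ler_norm_pexp (trial_prob01 heta) _)).
    rewrite -[leRHS](pexp_cst psM); apply: le_pexp => [i|x]; last exact: inc.
    exact: (trial_prob01 heta i).
  have dgSM : `|dgS - dgM| <= 2 * D * d.
    exact: (pexp_dist (h := fun j => stein_sol Z N A j.+2%:Z - stein_sol Z N A j.+1%:Z)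
      inc dP).
  have T1 : `|(cM - cS) * dgM| <= `|(1 - w * b) * tau| * D.
    by rewrite cMS normrM normrN ler_wpM2l.
  have T2 : `|cS * (dgS - dgM)| <= w2 * (2 * D * d).
    by rewrite normrM; apply: ler_pM.
  have errD : D * (errS + errM + `|(1 - w * b) * tau|) <= D * eps by rewrite ler_wpM2l.
  rewrite (_ : sA A - mA A = (sA A - eA A - cS * dgS) - (mA A - eA A - cM * dgM)
    + (cS * (dgS - dgM) - (cM - cS) * dgM)); last by ring.
  apply: (le_trans (ler_normD _ _)).
  apply: (le_trans (lerD (ler_normB _ _) (ler_normB _ _))).
  apply: (le_trans (lerD (lerD hS hM) (lerD T2 T1))).
  rewrite -/outS -/outM; lra.
(* d occurs on both sides; its coefficient on the right is below 1 because
   mn <= gamma^-1 and w1 * w2 < gamma *)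
have dle : d <= D * (eps + 2 * (w2 * d)) + outS + outM.
  by apply: dTV_le => A; rewrite sAE mAE; exact: main.
have gw : 0 < gamma - w1 * w2 by rewrite subr_gt0.
have w20 : 0 <= w2 by apply: le_trans cSw2.
rewrite -/outS -/outM mulrAC ler_pdivlMr ?mulr_gt0//.
have absorb : gamma * (w1 * w2 * d * mn) <= w1 * w2 * d.
  rewrite mulrCA; apply: ler_piMr.
    by apply: mulr_ge0 => //; apply: mulr_ge0 => //; exact: ltW.
  by rewrite mulrC -ler_pdivlMr// div1r.
have : gamma * (2 * d) <= gamma * (w1 * eps * mn + 2 * outS + 2 * outM
    + 2 * (w1 * w2 * d * mn)).
  by rewrite ler_wpM2l ?(ltW hgamma)//; move: dle; rewrite /D; lra.
lra.
Qed.
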